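(* Let $A$ be a finite-dimensional graded vector space over $\Bbbk$ and $d\in\mathbb Z$. Then the data of a pre-Calabi-Yau structure of dimension $d$ on $A$ is equivalent to the data of a cyclic $A_\infty$-structure of dimension $d-1$ on the space $A\oplus A^\vee[1-d]$ (cyclic with respect to the standard pairing), such that the subspace $A$ is an $A_\infty$-subalgebra.
   Context: $\Bbbk$ is a field of characteristic zero; graded means $\mathbb Z$-graded (cohomological), $(V[1])^n=V^{n+1}$, and $\bar a=\deg a-1$ is the degree of $a\in V$ in $V[1]$. $A^\vee=\mathrm{Hom}_\Bbbk(A,\Bbbk)$. Higher cochains: $C^*_{(k)}(A)=\prod_{n_1,\dots,n_k\ge0}\mathrm{Hom}(A[1]^{\otimes n_1}\otimes\dots\otimes A[1]^{\otimes n_k},A^{\otimes k})$. Write $\phi(a^1_1,\dots,a^1_{n_1};\dots;a^k_1,\dots,a^k_{n_k})=\sum b_1\otimes\dots\otimes b_k$; picture $\phi$ as a planar vertex with $k$ outputs in clockwise order, the $i$-th group of inputs lying (clockwise) in the angle between the $i$-th and $(i+1)$-st outputs. $\deg\phi$ is the degree as a map to $A^{\otimes k}$. The generator $t$ of $\mathbb Z_k$ acts (''action of dimension $d$'') by $(t\phi)(a^2;\dots;a^k;a^1)=(-1)^{\#_a+(d-1)(k-1)}\sum(-1)^{\#_b}b_2\otimes\dots\otimes b_k\otimes b_1$, where $\#_a$, $\#_b$ are the Koszul exponents for elements of $A[1]$. Set $C^*_{(k,d)}(A)=(C^*_{(k)}(A))^{(\mathbb Z_k,d)}[(d-2)(k-1)]$,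 with degree $|\phi|=\deg\phi-(d-2)(k-1)$, and $C^*_{[d]}(A)=\prod_{k\ge1}C^*_{(k,d)}(A)$. Necklace product of $\phi\in C^*_{(k,d)}$, $\psi\in C^*_{(\ell,d)}$: $\phi\circ_{\rm nec}\psi=\sum_{n=1}^k(-1)^{r_n}P_n+\sum_{m=1}^{\ell-1}(-1)^{s_m}R_m$ with $r_n=(\ell-1)(d-1)(k-n+|\phi|+1)$, $s_m=(\ell-1)(d-1)(|\phi|+1)+(k-1)(d-1)m$. $P_n$: glue the first output of $\psi$ to an input in the $n$-th angle of $\phi$; output order: outputs $1,\dots,n$ of $\phi$, outputs $2,\dots,\ell$ of $\psi$, outputs $n+1,\dots,k$ of $\phi$. $R_m$: glue the $(m+1)$-st output of $\psi$ to an input in the last angle of $\phi$; output order: outputs $1,\dots,m$ of $\psi$, all outputs of $\phi$, remaining outputs of $\psi$. Each glued tree is evaluated by summing over all planar distributions of the inputs (read clockwise from the first output) to the two vertices, applying $\psi$ and then $\phi$ and finally reordering outputs, always with Koszul signs for elements of $A[1]$. A pre-CY structure of dimension $d$ on $A$ is $m=\sum_{k\ge1}m_{(k)}\in C^*_{[d]}(A)$ of degree $|m|=2$ with $m\circ_{\rm nec}m=0$ (and $m_{(1)}^0=0$). An $A_\infty$-structure on a graded vector space $B$ is a collection $\mu^n:B[1]^{\otimes n}\to B[1]$, $n\ge1$, of degree $1$ with $\mu\circ\mu=0$ (Gerstenhaber product). A cyclic $A_\infty$-structure of dimension $e$ on $B$ is an $A_\infty$-structure together with a nondegenerate pairing $\langle-,-\rangle:B\otimes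 B\to\Bbbk[-e]$, graded skew-symmetric with respect to shifted degrees, such that for all $n$ the tensor $\langle\mu^n(-,\dots,-),-\rangle$ is invariant under cyclic permutations with Koszul signs for elements of $B[1]$; equivalently $\langle\mu^n(a_1,\dots,a_n),a_{n+1}\rangle=(-1)^{\bar a_1+1}\langle a_1,\mu^n(a_2,\dots,a_{n+1})\rangle$. The standard pairing on $A\oplus A^\vee[1-d]$ vanishes on $A\otimes A$ and on $A^\vee[1-d]\otimes A^\vee[1-d]$ and is the evaluation pairing between $A^\vee[1-d]$ and $A$. *)

(* Defs.v *)
From HB Require Import structures.
From mathcomp Require Import all_boot all_order all_algebra.
From mathcomp Require Import classical_sets functions.

Set Implicit Arguments.
Unset Strict Implicit.
Unset Printing Implicit Defensive.

Import Order.TTheory GRing.Theory Num.Theory.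
Local Open Scope ring_scope.

(* Finite-dimensional graded vector spaces; gs_part A n is A^n. *)
Record gradedSpace (K : fieldType) := GradedSpace {
  gs_sort :> vectType K;
  gs_supp : seq int;
  gs_part : int -> {vspace gs_sort};
  gs_out : forall n, n \notin gs_supp -> gs_part n = 0%VS;
  gs_dir : directv (\sum_(n : seq_sub gs_supp) gs_part (val n));
  gs_full : fullv = (\sum_(n : seq_sub gs_supp) gs_part (val n))%VS
}.
Arguments gs_supp {K} A : rename.
Arguments gs_part {K} A n : rename.

Definition gproj (K : fieldType) (A : gradedSpace K)
    (n : seq_sub (gs_supp A)) : 'End(A) :=
  sumv_pi_for (gs_full A) n.

Lemma big_seq_sub (R : Type) (idx : R) (op : Monoid.com_law idx)
    (s : seq int) (F : int -> R) :
  \big[op/idx]_(n : seq_sub s) F (val n) = \big[op/idx]_(n <- undup s) F n.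
Proof.
rewrite -(big_map val xpredT F); apply: perm_big; apply: uniq_perm.
- by rewrite map_inj_uniq ?index_enum_uniq //; apply: val_inj.
- exact: undup_uniq.
move=> n; rewrite mem_undup; apply/mapP/idP => [[x _ ->]|ns]; first exact: valP.
by exists (SeqSub ns); rewrite ?mem_index_enum.
Qed.

(* V[m], with V[m]^n = V^(n + m) *)
Section Shift.
Context (K : fieldType) (V : gradedSpace K) (m : int).
Let supp := [seq n - m | n <- gs_supp V].
Let part n := gs_part V (n + m).

Fact gshift_out n : n \notin supp -> part n = 0%VS.
Proof.
move=> nS; apply: gs_out; apply: contra nS => nS.
by apply/mapP; exists (n + m); rewrite ?addrK.
Qed.

Fact gshift_full : fullv = (\sum_(n : seq_sub supp) part (val n))%VS.
Proof.
rewrite big_seq_sub undup_map_inj ?big_map; last exact: addIr.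
by rewrite gs_full big_seq_sub; apply: eq_bigr => n _; rewrite /part subrK.
Qed.

Fact gshift_dir : directv (\sum_(n : seq_sub supp) part (val n)).
Proof.
rewrite directvE /= -gshift_full gs_full; have := gs_dir V.
rewrite directvE /= => /eqP ->; apply/eqP.
rewrite (big_seq_sub _ _ (fun n => \dim (part n))) undup_map_inj ?big_map;
  last exact: addIr.
rewrite (big_seq_sub _ _ (fun n => \dim (gs_part V n))).
by apply: eq_bigr => n _; rewrite /part subrK.
Qed.

Definition gshift := GradedSpace gshift_out gshift_dir gshift_full.
End Shift.

Definition pre_lfun (K : fieldType) (U V W : vectType K) (g : 'Hom(U, V))
  (f : 'Hom(V, W)) : 'Hom(U, W) := (f \o g)%VF.

Fact pre_lfun_linear (K : fieldType) (U V W : vectType K) (g : 'Hom(U, V)) :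
  linear (@pre_lfun K U V W g).
Proof. by move=> c x y; rewrite /pre_lfun comp_lfunDl comp_lfunZl. Qed.
HB.instance Definition _ (K : fieldType) (U V W : vectType K) (g : 'Hom(U, V)) :=
  GRing.isLinear.Build K 'Hom(V, W) 'Hom(U, W) _ (pre_lfun g)
    (@pre_lfun_linear K U V W g).

Definition annihilator (K : fieldType) (V : vectType K) (U : {vspace V}) :
    {vspace 'Hom(V, K^o)} :=
  lker (linfun (@pre_lfun K V V K^o (projv U))).

Lemma memv_annihilator (K : fieldType) (V : vectType K) (U : {vspace V})
    (f : 'Hom(V, K^o)) :
  reflect (forall u, u \in U -> f u = 0) (f \in annihilator U).
Proof.
rewrite memv_ker lfunE /=; apply: (iffP eqP) => [f0 u uU|f0].
  by move/lfunP/(_ u): f0; rewrite lfunE /= projv_id // lfunE.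
by apply/lfunP => v; rewrite lfunE /= f0 ?lfunE // memv_proj.
Qed.

(* The graded dual: degree n consists of the functionals supported on A^(-n). *)
Section Dual.
Context (K : fieldType) (A : gradedSpace K).
Let supp := [seq - n | n <- gs_supp A].
Let others (n : int) := (\sum_(q <- undup (gs_supp A) | q != n) gs_part A q)%VS.
Let part (n : int) := annihilator (others (- n)).

Let otherP (q n : int) (a : A) : a \in gs_part A q -> q != n -> a \in others n.
Proof.
move=> aq qn; have [qS|qS] := boolP (q \in gs_supp A); last first.
  by move: aq; rewrite gs_out // memv0 => /eqP ->; rewrite mem0v.
rewrite /others -mem_undup in qS *; rewrite big_mkcond (big_rem q qS) /= qn.
by apply: subvP aq; exact: addvSl.
Qed.

Let partP (n : int) (f : 'Hom(A, K^o)) :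
  reflect (forall q a, q != - n -> a \in gs_part A q -> f a = 0) (f \in part n).
Proof.
apply: (iffP (memv_annihilator _ _)) => f0 => [q a qn aq|u].
  by apply: f0; apply: otherP aq qn.
suff : (others (- n) <= lker f)%VS by move=> /subvP h /h; rewrite memv_ker => /eqP.
rewrite /others; apply: (big_ind (fun U : {vspace A} => (U <= lker f)%VS)).
- exact: sub0v.
- by move=> U W UV WV; rewrite subv_add UV.
by move=> q qn; apply/subvP => a aq; rewrite memv_ker (f0 q).
Qed.

Let sum_gproj (a : A) : \sum_n gproj n a = a.
Proof. by apply: sumv_pi_sum; exact: memvf. Qed.

Let gprojP n (a : A) : gproj n a \in gs_part A (val n).
Proof. exact: memv_sum_pi. Qed.

Fact gdual_out n : n \notin supp -> part n = 0%VS.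
Proof.
move=> nS; apply/eqP; rewrite -subv0; apply/subvP => f /partP f0.
rewrite memv0; apply/eqP/lfunP => a; rewrite lfunE -[a]sum_gproj linear_sum /=.
apply: big1 => i _; apply: (f0 (val i)) => //; apply: contra nS => /eqP iE.
by apply/mapP; exists (val i); [exact: valP | rewrite iE opprK].
Qed.


Fact gdual_dir : directv (\sum_(n : seq_sub supp) part (val n)).
Proof.
apply/directv_sum_independent => us us_part us0 i _; apply/lfunP => a.
rewrite lfunE -[a]sum_gproj linear_sum /=; apply: big1 => n _.
have [nE|/eqP nE] := eqVneq (val n) (- val i); last first.
  by move/partP: (us_part i isT) => /(_ (val n)); apply=> //; exact/eqP.
move/lfunP: us0 => /(_ (gproj n a)); rewrite sum_lfunE lfunE /= (bigD1 i) //=.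
rewrite [X in _ + X]big1 ?addr0 // => j ji.
move/partP: (us_part j isT) => /(_ (val n)); apply=> //.
by rewrite nE eqr_opp eq_sym; apply: contra ji => /eqP/val_inj ->.
Qed.

Fact gdual_full : fullv = (\sum_(n : seq_sub supp) part (val n))%VS.
Proof.
apply/esym/eqP; rewrite eqEsubv subvf; apply/subvP => f _.
have -> : f = \sum_(n : seq_sub (gs_supp A)) (f \o gproj n)%VF.
  apply/lfunP => a; rewrite sum_lfunE -{1}[a]sum_gproj linear_sum /=.
  by apply: eq_bigr => n _; rewrite comp_lfunE.
apply: memv_suml => n _; have nS := map_f (fun q => - q) (valP n).
apply: (subvP (sumv_sup (SeqSub nS) _ (subvv _)) _ _) => //=.
apply/partP => q a; rewrite opprK comp_lfunE => qn aq.
suff -> : gproj n a = 0 by rewrite linear0.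
have [qS|qS] := boolP (q \in gs_supp A); last first.
  by move: aq; rewrite gs_out // memv0 => /eqP ->; rewrite linear0.
have /directv_sum_unique := gs_dir A.
pose vs (i : seq_sub (gs_supp A)) := if val i == q then a else 0.
move/(_ (fun i => gproj i a) vs (fun i _ => gprojP i a)).
have vsP i : true -> vs i \in gs_part A (val i).
  by rewrite /vs; case: eqP => [->|_] _; rewrite ?mem0v.
move/(_ vsP); rewrite sum_gproj (bigD1 (SeqSub qS)) //= /vs /= eqxx.
rewrite big1 ?addr0 ?eqxx => [|i /eqP iq]; last first.
  by case: eqP => // iE; case: iq; exact: val_inj.
by move/esym/forallP/(_ n)/eqP => -> /=; rewrite eq_sym (negbTE qn).
Qed.

Definition gdual := GradedSpace gdual_out gdual_dir gdual_full.

Lemma mem_gdual (n : int) (f : 'Hom(A, K^o)) :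
  reflect (forall q a, q != - n -> a \in gs_part A q -> f a = 0)
          (f \in gs_part gdual n).
Proof. exact: partP. Qed.
End Dual.

(* The direct sum, with degree n part A^n x V^n. *)
Section Sum.
Context (K : fieldType) (A V : gradedSpace K).
Let W : vectType K := (A * V)%type.
Let supp := gs_supp A ++ gs_supp V.

Definition inA (a : A) : W := (a, 0).
Definition inV (v : V) : W := (0, v).

Fact inA_linear : linear inA.
Proof. by move=> c x y; rewrite /inA; congr pair; rewrite /= scaler0 addr0. Qed.
HB.instance Definition _ := GRing.isLinear.Build K A W _ inA inA_linear.
Fact inV_linear : linear inV.
Proof. by move=> c x y; rewrite /inV; congr pair; rewrite /= scaler0 addr0. Qed.
HB.instance Definition _ := GRing.isLinear.Build K V W _ inV inV_linear.

Let part (n : int) : {vspace W} :=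
  (linfun inA @: gs_part A n + linfun inV @: gs_part V n)%VS.

Let partP (n : int) (w : W) :
  (w \in part n) = (w.1 \in gs_part A n) && (w.2 \in gs_part V n).
Proof.
apply/idP/andP => [/memv_addP[_ /memv_imgP[a aA ->] [_ /memv_imgP[v vV ->] ->]]|].
  by rewrite !lfunE /= addr0 add0r.
case: w => a v /= [aA vV]; apply/memv_addP.
exists (inA a); first by apply/memv_imgP; exists a; rewrite ?lfunE.
exists (inV v); first by apply/memv_imgP; exists v; rewrite ?lfunE.
by congr pair; rewrite /= ?addr0 ?add0r.
Qed.

Fact gsum_out n : n \notin supp -> part n = 0%VS.
Proof.
rewrite mem_cat negb_or => /andP[nA nV].
by rewrite /part (gs_out nA) (gs_out nV) !limg0 addv0.
Qed.

Let sum_supp (U : vectType K) (P : int -> {vspace U}) (s : seq int) :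
  {subset s <= supp} -> (forall n, n \notin s -> P n = 0%VS) ->
  (\sum_(n : seq_sub supp) P (val n) = \sum_(n : seq_sub s) P (val n))%VS.
Proof.
move=> ss P0; rewrite !big_seq_sub (bigID (mem s)) /=.
rewrite [X in (_ + X)%VS]big1 => [|n /P0 //]; rewrite addv0 -big_filter.
apply: perm_big; apply: uniq_perm; rewrite ?filter_uniq ?undup_uniq // => n.
by rewrite mem_filter !mem_undup; case: (boolP (n \in s)) => //= /ss.
Qed.

(* The abstraction over P keeps directv from looking inside the sum part n. *)
Fact gsum_dir : (fun P : int -> {vspace W} =>
  directv (\sum_(n : seq_sub supp) P (val n)) : Prop) part.
Proof.
apply: (introT directv_sum_independent) => us us_part us0 i _.
have vanish (U : gradedSpace K) (xs : seq_sub supp -> U) :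
    (forall n, xs n \in gs_part U (val n)) -> \sum_n xs n = 0 -> xs i = 0.
  move=> xsU xs0.
  have [iU|iU] := boolP (val i \in gs_supp U); last first.
    by move: (xsU i); rewrite gs_out // memv0 => /eqP.
  pose ys (n : seq_sub (gs_supp U)) :=
    \sum_(j : seq_sub supp | val j == val n) xs j.
  have dU := elimT directv_sum_independent (gs_dir U).
  have ysU n : true -> ys n \in gs_part U (val n).
    by move=> _; apply: memv_suml => j /eqP <-.
  have ys0 : \sum_n ys n = 0.
    rewrite -[RHS]xs0 (exchange_big_dep xpredT) //=; apply: eq_bigr => j _.
    have [jU|jU] := boolP (val j \in gs_supp U).
      by rewrite (big_pred1 (SeqSub jU)).
    rewrite big1 => [|n /eqP jn]; last first.
      by case/negP: jU; rewrite /= jn; exact: valP.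
    by move: (xsU j); rewrite gs_out // memv0 => /eqP.
  by move: (dU ys ysU ys0 (SeqSub iU) isT); rewrite /ys (big_pred1 i).
have us_in n := us_part n isT.
have usA : (us i).1 = 0.
  apply: (vanish A (fun n => (us n).1)) => [n|].
    by move: (us_in n); rewrite partP => /andP[].
  by rewrite -(raddf_sum (@fst A V : {additive W -> A})) us0.
have usV : (us i).2 = 0.
  apply: (vanish V (fun n => (us n).2)) => [n|].
    by move: (us_in n); rewrite partP => /andP[].
  by rewrite -(raddf_sum (@snd A V : {additive W -> V})) us0.
by move: usA usV; case: (us i) => a v /= -> ->.
Qed.

Fact gsum_full : fullv = (\sum_(n : seq_sub supp) part (val n))%VS.
Proof.
rewrite /part big_split /= -!limg_sum.
rewrite (sum_supp (s := gs_supp A)) -?gs_full; last exact: gs_out.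
  rewrite (sum_supp (s := gs_supp V)) -?gs_full; last exact: gs_out.
    apply/esym/eqP; rewrite eqEsubv subvf; apply/subvP => -[a v] _.
    apply/memv_addP; exists (inA a); first by apply/memv_imgP; exists a; rewrite ?memvf ?lfunE.
    exists (inV v); first by apply/memv_imgP; exists v; rewrite ?memvf ?lfunE.
    by congr pair; rewrite /= ?addr0 ?add0r.
  by move=> n; rewrite mem_cat => ->; rewrite orbT.
by move=> n; rewrite mem_cat => ->.
Qed.

Definition gsum := GradedSpace gsum_out gsum_dir gsum_full.

Lemma mem_gsum (n : int) (w : A * V) :
  (w \in gs_part gsum n) = (w.1 \in gs_part A n) && (w.2 \in gs_part V n).
Proof. exact: partP. Qed.
End Sum.

(* Koszul signs need degrees, so signed identities are stated on vectors that
   carry the degree they are taken to have; the signs are those of V[1]. *)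
Definition gelt (K : fieldType) (V : gradedSpace K) : Type := (int * V)%type.

Definition homog (K : fieldType) (V : gradedSpace K) (x : gelt V) : bool :=
  x.2 \in gs_part V x.1.

Definition degs (K : fieldType) (V : gradedSpace K) (s : seq (gelt V)) :
  seq int := [seq x.1 | x <- s].

Definition vecs (K : fieldType) (V : gradedSpace K) (s : seq (gelt V)) :
  seq V := [seq x.2 | x <- s].

Definition sbar (K : fieldType) (V : gradedSpace K) (s : seq (gelt V)) : int :=
  \sum_(x <- s) (x.1 - 1).

Definition multilinear (K : fieldType) (V W : lmodType K) (f : seq V -> W) :=
  forall s1 s2 : seq V, linear (fun v => f (s1 ++ v :: s2)).

(* A collection (mu^n)_n of multilinear operations is one function on lists:
   mu^n is its restriction to lists of length n. *)
Definition gerstenhaber (K : fieldType) (B : gradedSpace K) (q : int)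
    (mu nu : seq B -> B) (s : seq (gelt B)) : B :=
  \sum_(i < (size s).+1) \sum_(j < (size s).+1 | (i <= j)%N)
    (-1) ^ (q * sbar (take i s)) *:
      mu (vecs (take i s) ++ nu (vecs (drop i (take j s))) :: vecs (drop j s)).

Record is_Ainf (K : fieldType) (B : gradedSpace K) (mu : seq B -> B) : Prop :=
  IsAinf {
    Ainf_nil : mu [::] = 0;
    Ainf_linear : multilinear mu;
    (* degree 1 on B[1] *)
    Ainf_degree : forall s : seq (gelt B), all (@homog K B) s ->
      mu (vecs s) \in gs_part B (sbar s + 2);
    Ainf_relation : forall s : seq (gelt B), all (@homog K B) s ->
      gerstenhaber 1 mu mu s = 0
  }.

Record is_pairing (K : fieldType) (B : gradedSpace K) (e : int)
    (pr : B -> B -> K) : Prop := IsPairing {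
  pairing_linearl : forall y, scalar (pr^~ y);
  pairing_linearr : forall x, scalar (pr x);
  pairing_degree : forall x y : gelt B, homog x -> homog y ->
    x.1 + y.1 != e -> pr x.2 y.2 = 0;
  pairing_skew : forall x y : gelt B, homog x -> homog y ->
    pr x.2 y.2 = - ((-1) ^ ((x.1 - 1) * (y.1 - 1)) * pr y.2 x.2);
  pairing_nondegenerate : forall x, (forall y, pr x y = 0) -> x = 0
}.

Record is_cyclic_Ainf (K : fieldType) (B : gradedSpace K) (e : int)
    (pr : B -> B -> K) (mu : seq B -> B) : Prop := IsCyclicAinf {
  cyclic_Ainf : is_Ainf mu;
  cyclic_pairing : is_pairing e pr;
  cyclic_invariant : forall (x z : gelt B) (s : seq (gelt B)),
    homog x -> homog z -> all (@homog K B) s ->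
    pr (mu (x.2 :: vecs s)) z.2 =
      (-1) ^ ((x.1 - 1) * sbar (rcons s z)) * pr (mu (rcons (vecs s) z.2)) x.2
}.

(* A + A^v[1 - d] *)
Definition dual_double (K : fieldType) (A : gradedSpace K) (d : int) :
    gradedSpace K :=
  gsum A (gshift (gdual A) (1 - d)).

(* <f, a> = f a, and <a, f> = - (-1) ^ (abar * fbar) f a by skew-symmetry, where
   f has degree d - 1 - n, hence fbar = d - 2 - n, if a has degree n. *)
Definition standard_pairing (K : fieldType) (A : gradedSpace K) (d : int)
    (x y : dual_double A d) : K :=
  (x.2 y.1 : K) - \sum_(n : seq_sub (gs_supp A))
    (-1) ^ ((val n - 1) * (d - 2 - val n)) * (y.2 (gproj n x.1) : K).

Definition is_subalgebra (K : fieldType) (A : gradedSpace K) (d : int)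
    (mu : seq (dual_double A d) -> dual_double A d) : Prop :=
  forall s : seq A, (mu [seq inA _ a | a <- s]).2 = 0.

(* Indices of a homogeneous basis of A; the tensors x_1 (x) ... (x) x_k form the
   basis of A^(x)k on which tensors are expanded. *)
Definition bidx (K : fieldType) (A : gradedSpace K) : finType :=
  {n : seq_sub (gs_supp A) & 'I_(\dim (gs_part A (val n)))}.

Definition bdeg (K : fieldType) (A : gradedSpace K) (x : bidx A) : int :=
  val (tag x).

Definition bvec (K : fieldType) (A : gradedSpace K) (x : bidx A) : A :=
  (vbasis (gs_part A (val (tag x))))`_(tagged x).

Definition belt (K : fieldType) (A : gradedSpace K) (x : bidx A) : gelt A :=
  (bdeg x, bvec x).

Definition obar (K : fieldType) (A : gradedSpace K) (o : seq (bidx A)) : int :=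
  \sum_(x <- o) (bdeg x - 1).

(* The coefficients of a tensor; those of an element of A^(x)k vanish on lists of
   length different from k. *)
Definition tensor (K : fieldType) (A : gradedSpace K) : Type :=
  seq (bidx A) -> K.

(* An element of the product over k of the C_(k)(A): phi [:: a1; ...; ak] is
   phi_(k)(a1; ...; ak), where each ai is a list of inputs. *)
Definition cochain (K : fieldType) (A : gradedSpace K) : Type :=
  seq (seq A) -> tensor A.

(* phi belongs to C_[d](A) and |phi| = p *)
Record is_cochain (K : fieldType) (A : gradedSpace K) (d p : int)
    (phi : cochain A) : Prop := IsCochain {
  cochain_nil : forall o, phi [::] o = 0;
  cochain_size : forall c o, size o != size c -> phi c o = 0;
  cochain_linear : forall c1 c2 o,
    multilinear (fun s : seq A => phi (c1 ++ s :: c2) o : K^o);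
  cochain_degree : forall (c : seq (seq (gelt A))) o,
    all (all (@homog K A)) c -> phi (map (@vecs K A) c) o != 0 ->
    \sum_(x <- o) bdeg x =
      sbar (flatten c) + p + (d - 2) * ((size c)%:Z - 1);
  cochain_cyclic : forall a c x o,
    all (@homog K A) a -> all (all (@homog K A)) c ->
    phi (rcons (map (@vecs K A) c) (vecs a)) (rcons o x) =
      (-1) ^ (sbar a * sbar (flatten c) + (d - 1) * (size c)%:Z
              + (bdeg x - 1) * obar o)
      * phi (vecs a :: map (@vecs K A) c) (x :: o)
}.

(* The degree of phi_(k) as a map from tensors over A[1] to A[1]^(x)k, when
   |phi| = p. *)
Definition opbar (d p : int) (k : nat) : int :=
  p + (d - 2) * (k%:Z - 1) - k%:Z.

Definition cut (T : Type) (i j : nat) (g : seq (seq T)) : seq (seq T) :=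
  if set_nth [::] g (size g).-1 (take j (last [::] g)) is h :: t
  then drop i h :: t else [::].

(* (-1)^(r_n) P_n, evaluated on the groups c, at the output tensor o. With
   cn = c^n and ce = c^(n+l-1) (the same group if l = 1), the inputs x = take i cn
   and y = drop j ce enter the n-th angle of phi, around the glued edge z, and
   what remains between them goes to psi. First psi is applied past the inputs
   on its left, then its outputs 2..l move right past the remaining inputs of
   phi, and after applying phi past the outputs n+1..k of phi. *)
Definition necP (K : fieldType) (A : gradedSpace K) (d p q : int)
    (phi psi : cochain A) (k l n : nat)
    (c : seq (seq (gelt A))) (o : seq (bidx A)) : K :=
  let cn := nth [::] c n.-1 in
  let ce := nth [::] c (n + l - 2) in
  let pre := take n.-1 c in
  let post := drop (n + l - 1) c in
  let oL := take n o in
  let oM := take l.-1 (drop n o) in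
  let oR := drop (n + l - 1) o in
  \sum_(i < (size cn).+1) \sum_(j < (size ce).+1 | (l == 1%N) ==> (i <= j)%N)
  \sum_(z : bidx A)
    let x := take i cn in
    let y := drop j ce in
    let g := cut i j (take l (drop n.-1 c)) in
    (-1) ^ ((l%:Z - 1) * (d - 1) * (k%:Z - n%:Z + p + 1)
            + opbar d q l * (sbar (flatten pre) + sbar x)
            + obar oM * (sbar y + sbar (flatten post))
            + obar oM * obar oR)
    * psi (map (@vecs K A) g) (z :: oM)
    * phi (map (@vecs K A) (pre ++ (x ++ belt z :: y) :: post)) (oL ++ oR).

(* (-1)^(s_m) R_m. With cm = c^m and ce = c^(m+k), the inputs y = drop i cm and
   x = take j ce enter the last angle of phi, after and before the glued edge z;
   the groups F are the other ones of phi. First the inputs y, F, x of phi move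
   right past those of psi that follow them, then psi is applied, its outputs
   m+2..l move right past y, F, x, the block z, y moves right past F, x, and phi
   is applied past the outputs 1..m of psi. *)
Definition necR (K : fieldType) (A : gradedSpace K) (d p : int)
    (phi psi : cochain A) (k l m : nat)
    (c : seq (seq (gelt A))) (o : seq (bidx A)) : K :=
  let cm := nth [::] c m.-1 in
  let ce := nth [::] c (m + k).-1 in
  let pre := take m.-1 c in
  let F := take k.-1 (drop m c) in
  let post := drop (m + k) c in
  let oL := take m o in
  let oM := take k (drop m o) in
  let oR := drop (m + k) o in
  \sum_(i < (size cm).+1) \sum_(j < (size ce).+1) \sum_(z : bidx A)
    let x := take j ce in
    let y := drop i cm in
    let yFx := sbar y + sbar (flatten F) + sbar x in
    (-1) ^ ((l%:Z - 1) * (d - 1) * (p + 1) + (k%:Z - 1) * (d - 1) * m%:Z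
            + yFx * (sbar (drop j ce) + sbar (flatten post))
            + obar oR * yFx
            + (bdeg z - 1 + sbar y) * (sbar (flatten F) + sbar x)
            + opbar d p k * obar oL)
    * psi (map (@vecs K A) (pre ++ take i cm :: drop j ce :: post))
        (oL ++ z :: oR)
    * phi (map (@vecs K A) (rcons F (x ++ belt z :: y))) oM.

(* phi o_nec psi for |phi| = p and |psi| = q, on c and at o; the component
   (k, l) has N = k + l - 1 outputs. *)
Definition necklace (K : fieldType) (A : gradedSpace K) (d p q : int)
    (phi psi : cochain A) (c : seq (seq (gelt A))) (o : seq (bidx A)) : K :=
  let N := size c in
  \sum_(1 <= k < N.+1)
    let l := (N.+1 - k)%N in
    (\sum_(1 <= n < k.+1) necP d p q phi psi k l n c o
     + \sum_(1 <= m < l) necR d p phi psi k l m c o).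

Record is_preCY (K : fieldType) (A : gradedSpace K) (d : int)
    (m : cochain A) : Prop := IsPreCY {
  preCY_cochain : is_cochain d 2 m;
  preCY_necklace : forall (c : seq (seq (gelt A))) o,
    all (all (@homog K A)) c -> size o = size c -> necklace d 2 2 m m c o = 0;
  preCY_uncurved : forall o, m [:: [::]] o = 0
}.

(* (f_1 (x) ... (x) f_k)(t), for t in A^(x)k *)
Definition tensor_eval (K : fieldType) (A : gradedSpace K) (t : tensor A)
    (f : seq 'Hom(A, K^o)) : K :=
  \sum_(x : (size f).-tuple (bidx A))
    t x * \prod_(fx <- zip f x) (fx.1 (bvec fx.2) : K).

(* <mu(a^1, f_2, a^2, ..., f_k, a^k), f_1> is, up to a sign that depends only on
   the degrees, (f_1 (x) ... (x) f_k)(m(a^1; ...; a^k)): read clockwise from the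
   first output, the legs of the vertex m_(k) are f_1, a^1, f_2, ..., f_k, a^k. *)
Definition corresponds (K : fieldType) (A : gradedSpace K) (d : int)
    (eps : seq (seq int) -> seq int -> bool)
    (m : cochain A) (mu : seq (dual_double A d) -> dual_double A d) : Prop :=
  forall (a : seq (gelt A)) (c : seq (seq (gelt A)))
    (f : gelt (gshift (gdual A) (1 - d)))
    (g : seq (gelt (gshift (gdual A) (1 - d)))),
    all (@homog K A) a -> all (all (@homog K A)) c ->
    homog f -> all (@homog _ _) g -> size g = size c ->
    standard_pairing
      (mu ([seq inA _ v | v <- vecs a]
           ++ flatten [seq inV _ gb.1 :: [seq inA _ v | v <- gb.2]
                      | gb <- zip (vecs g) (map (@vecs K A) c)]))
      (inV _ f.2)
    = (-1) ^+ eps (map (@degs K A) (a :: c)) (degs (f :: g))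
      * tensor_eval (m (map (@vecs K A) (a :: c))) (vecs (f :: g)).

(* Main.v *)
From HB Require Import structures.
Require Import Defs.
From mathcomp Require Import all_boot all_order all_algebra.
From mathcomp Require Import ring zify.
From mathcomp Require Import boolp classical_sets functions.

Set Implicit Arguments.
Unset Strict Implicit.
Unset Printing Implicit Defensive.

Import Order.TTheory GRing.Theory Num.Theory.
Local Open Scope ring_scope.
Local Open Scope classical_set_scope.


(** A cyclic structure mu on B = A + A^v[1 - d] is the same thing as the tensor
    <mu(b_1, ..., b_n), b_(n+1)> on cyclic words in B, and the letters b_i may
    be taken in A or in the dual basis of A^v.  A word with k >= 1 dual letters
    can be rotated until a dual letter comes last, and then it reads
    a^1 f_2 a^2 ... f_k a^k f_1: these are the legs, read clockwise from the
    first output, of a planar vertex with outputs f_1, ..., f_k and groups of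
    inputs a^1, ..., a^k.  So the values of the tensor on such words are the
    coefficients of a family m_(k)(a^1; ...; a^k), while its values on words
    without dual letters vanish exactly when A is a subalgebra.  [word_corr]
    states this correspondence between m and mu, and [corr_sign] is the sign in
    it: it turns the Koszul signs of rotations in B[1] into the signs of the
    action of dimension d of Z_k ([letter_tensor_rot], [mu_cochain_cyclic]).

    Take now a word w f_1 ending with a dual letter.  The Gerstenhaber square
    paired with f_1 is the sum over the factorizations w = p q r of
    <mu(p, mu(q), r), f_1>.  Expand mu(q) in the basis of B.  Along a component
    in A the vertex of q puts its output into an input of the vertex of
    p, r, f_1, and this is a summand of P_n; along a component in A^v the vertex
    of p, r, f_1 puts an output into an input of the vertex of q, and this is a
    summand of R_m.  Two cuts of w determine n or m and the distribution of the
    inputs.  [inner_output_in_A] and [inner_output_in_dual] show that the signs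
    of the two expansions differ by a factor that depends on w f_1 only, hence
    the Gerstenhaber square is, up to sign, the necklace square
    ([necklace_relation]).

    If mu satisfies the A-infinity relation, the necklace square of m therefore
    vanishes.  Conversely the necklace equation gives the relation on words
    that end with a dual letter; the tensor <(mu o mu)(...), -> is itself cyclic
    ([gcyc_rot1]), so every word containing a dual letter follows by rotation,
    and on words in A the square stays inside A, on which the pairing is zero.

    Multilinear maps are determined by their values on basis letters, and both
    directions are built by multilinear extension: [preCY_mu] from m and
    [mu_cochain] from mu.  The uniqueness lemmas at the end make them inverse to
    each other. *)

(** * Parities of integer exponents *)

Definition oddz (z : int) : bool := odd `|z|%N.

Lemma oddz_nat (n : nat) : oddz n%:Z = odd n. Proof. by []. Qed.

Lemma oddzN z : oddz (- z) = oddz z. Proof. by rewrite /oddz abszN. Qed.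

Lemma oddzM x y : oddz (x * y) = oddz x && oddz y.
Proof. by rewrite /oddz abszM oddM. Qed.

Lemma exprN1z (R : unitRingType) (z : int) : (-1) ^ z = (-1) ^+ oddz z :> R.
Proof.
by case: z => n; rewrite /oddz /exprz ?NegzE ?abszN absz_nat signr_odd // -signr_odd invr_sign.
Qed.

Lemma oddzD x y : oddz (x + y) = oddz x (+) oddz y.
Proof.
suff: (-1) ^+ oddz (x + y) = (-1) ^+ (oddz x (+) oddz y) :> int.
  by case: oddz; case: (oddz x (+) oddz y).
by rewrite -exprN1z exprzDr // !exprN1z signr_addb.
Qed.

Definition oddzE := (oddzD, oddzM, oddzN, oddz_nat).

Lemma sign_mul (R : unitRingType) x y : (-1) ^ x * (-1) ^ y = (-1) ^ (x + y) :> R.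
Proof. by rewrite !exprN1z oddzD signr_addb. Qed.

Lemma sign_congr (R : unitRingType) x y : oddz x = oddz y -> (-1) ^ x = (-1) ^ y :> R.
Proof. by rewrite !exprN1z => ->. Qed.

Definition all_bool (f : bool -> bool) := f true && f false.
Lemma all_boolP f : all_bool f -> forall b, f b.
Proof. by case/andP => ft ff []. Qed.

(** A congruence mod 2 between polynomials in degrees becomes, after rewriting
    with [oddzE], an identity between boolean functions of the parities of the
    degrees; it is checked on all values of these parities. *)
Ltac truth_table :=
  try change (odd 1) with true; try change (odd 0) with false;
  rewrite /=;
  repeat match goal with
  | |- context [oddz ?z] => let b := fresh "b" in generalize (oddz z); intro b
  | |- context [odd ?z] => let b := fresh "b" in generalize (odd z); intro b
  end;
  repeat match goal with
  | b : bool |- is_true ?e =>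
      match eval pattern b in e with ?g b => refine (@all_boolP g _ b); clear b end
  end; vm_cast_no_check (erefl true).

Lemma parity_eq x y : oddz x == oddz y -> oddz x = oddz y.
Proof. by move/eqP. Qed.
(** The hypotheses [oddz h = false] are degree constraints: the signs of two
    terms need to agree only where the terms do not vanish. *)
Lemma parity_eq_if h x y : ~~ oddz h ==> (oddz x == oddz y) -> oddz h = false -> oddz x = oddz y.
Proof. by move/implyP => hxy h0; apply/eqP/hxy; rewrite h0. Qed.
Lemma parity_eq_if2 h h' x y : ~~ oddz h ==> (~~ oddz h' ==> (oddz x == oddz y)) ->
  oddz h = false -> oddz h' = false -> oddz x = oddz y.
Proof. by move/implyP => hxy h0 h0'; apply/eqP/(implyP (hxy _)); rewrite ?h0 ?h0'. Qed.

(** * Dual bases and the standard pairing *)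

(** The shape in which the defect of a signed identity is linear in one slot. *)
Lemma linear_sub_sign (R : comPzRingType) (s c u v u' v' : R) :
  c * u + v - s * (c * u' + v') = c * (u - s * u') + (v - s * v').
Proof. ring. Qed.

Section LinearFun.
Context (K : fieldType) (V W : lmodType K) (f : V -> W) (lf : linear f).

Lemma linear_zero : f 0 = 0.
Proof.
by have := lf 1 0 0; rewrite scaler0 add0r scale1r -{1}[f 0]addr0 => /addrI/esym.
Qed.
Lemma linear_add u v : f (u + v) = f u + f v.
Proof. by have := lf 1 u v; rewrite !scale1r. Qed.
Lemma linear_scale c u : f (c *: u) = c *: f u.
Proof. by have := lf c u 0; rewrite !addr0 linear_zero addr0. Qed.
Lemma linear_big_sum I (r : seq I) P (F : I -> V) :
  f (\sum_(i <- r | P i) F i) = \sum_(i <- r | P i) f (F i).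
Proof. exact: (big_morph f linear_add linear_zero). Qed.
End LinearFun.

Section Basis.
Context (K : fieldType) (A : gradedSpace K).
Implicit Types (x y z : bidx A) (a : A).

Lemma sum_gproj a : \sum_n gproj n a = a.
Proof. by apply: sumv_pi_sum; exact: memvf. Qed.

Lemma gproj_mem n a : gproj n a \in gs_part A (val n).
Proof. exact: memv_sum_pi. Qed.

Lemma gproj_part (n : int) a p : a \in gs_part A n ->
  gproj p a = if val p == n then a else 0.
Proof.
move=> an; have [nS|nS] := boolP (n \in gs_supp A); last first.
  by move: an; rewrite gs_out // memv0 => /eqP ->; rewrite linear0 if_same.
have /directv_sum_unique := gs_dir A.
pose vs (i : seq_sub (gs_supp A)) := if val i == n then a else 0.
move/(_ (fun i => gproj i a) vs (fun i _ => gproj_mem i a)).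
have vsP i : true -> vs i \in gs_part A (val i).
  by rewrite /vs; case: eqP => [->|_] _; rewrite ?mem0v.
move/(_ vsP); rewrite sum_gproj (bigD1 (SeqSub nS)) //= /vs /= eqxx.
rewrite big1 ?addr0 ?eqxx => [|i /eqP iq]; last first.
  by case: eqP => // iE; case: iq; exact: val_inj.
by move/esym/forallP/(_ p)/eqP.
Qed.

(** The functional dual to [bvec x]; it has degree [- bdeg x] in A^v. *)
Definition dvec x : 'Hom(A, K^o) :=
  (linfun (coord (vbasis (gs_part A (val (tag x)))) (tagged x) : A -> K^o)
   \o gproj (tag x))%VF.

Lemma dvecE x a : dvec x a =
  coord (vbasis (gs_part A (val (tag x)))) (tagged x) (gproj (tag x) a).
Proof. by rewrite comp_lfunE lfunE. Qed.

Lemma bvec_homog x : bvec x \in gs_part A (bdeg x).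
Proof. by apply: vbasis_mem; rewrite mem_nth // size_tuple. Qed.

Lemma dvec_bvec x y : dvec x (bvec y) = (x == y)%:R.
Proof.
rewrite dvecE (gproj_part _ (bvec_homog y)).
case: x y => [n i] [p j]; rewrite /bdeg /bvec /=; case: eqP => [/val_inj np|np].
  subst p; rewrite coord_free ?(basis_free (vbasisP _)) //.
  by rewrite eq_sym -tag_eqE /tag_eq /= eqxx tagged_asE.
rewrite linear0 -tag_eqE /tag_eq /=; case: (eqVneq n p) => [np'|//].
by case: np; rewrite np'.
Qed.

Lemma basis_expand a : a = \sum_x dvec x a *: bvec x.
Proof.
rewrite -[LHS]sum_gproj.
pose F (n : seq_sub (gs_supp A)) (j : 'I_(\dim (gs_part A (val n)))) :=
  coord (vbasis (gs_part A (val n))) j (gproj n a) *: (vbasis (gs_part A (val n)))`_j.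
transitivity (\sum_n \sum_j @F n j).
  by apply: eq_bigr => n _; exact: coord_vbasis (gproj_mem n a).
rewrite (sig_big_dep xpredT (fun=> xpredT) F); apply: eq_bigr => x _.
by rewrite dvecE.
Qed.

Lemma dvec_homog n a x : a \in gs_part A n -> bdeg x != n -> dvec x a = 0.
Proof.
by move=> an xn; rewrite dvecE (gproj_part _ an) -/(bdeg x) (negbTE xn) linear0.
Qed.

Lemma dual_expand (f : 'Hom(A, K^o)) : f = \sum_x f (bvec x) *: dvec x.
Proof.
apply/lfunP => a; rewrite sum_lfunE {1}[a]basis_expand linear_sum /=.
apply: eq_bigr => x _; rewrite scale_lfunE linearZ; exact: mulrC.
Qed.

Lemma dual_homog (d n : int) (f : gshift (gdual A) (1 - d)) x :
  f \in gs_part (gshift (gdual A) (1 - d)) n -> bdeg x != d - 1 - n ->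
  (f : 'Hom(A, K^o)) (bvec x) = 0.
Proof.
move=> /mem_gdual h xn; apply: h (bvec_homog x).
by apply: contra xn => /eqP ->; rewrite opprD opprB addrC.
Qed.

Lemma dvec_mem (d : int) x :
  (dvec x : gshift (gdual A) (1 - d)) \in
    gs_part (gshift (gdual A) (1 - d)) (d - 1 - bdeg x).
Proof.
apply/mem_gdual => q a qn aq; apply: dvec_homog aq _; apply: contra qn => /eqP <-.
by apply/eqP; ring.
Qed.
End Basis.

Section Pairing.
Context (K : fieldType) (A : gradedSpace K) (d : int).
Local Notation B := (dual_double A d).
Local Notation pr := (@standard_pairing K A d).
Implicit Types (x y z : bidx A) (v : B).

Lemma standard_pairing_homog (n : int) (u v : B) : u.1 \in gs_part A n ->
  pr u v = (u.2 v.1 : K) - (-1) ^ ((n - 1) * (d - 2 - n)) * (v.2 u.1 : K).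
Proof.
move=> un; rewrite /standard_pairing; congr (_ - _).
have [nS|nS] := boolP (n \in gs_supp A); last first.
  move: un; rewrite gs_out // memv0 => /eqP ->.
  by rewrite [in RHS]linear0 mulr0 big1 // => i _; rewrite !linear0 mulr0.
rewrite (bigD1 (SeqSub nS)) //= big1 ?addr0 => [|i].
  by rewrite (gproj_part _ un) eqxx.
move/eqP=> iq; rewrite (gproj_part _ un).
case: eqP => [iE|_]; last by rewrite linear0 mulr0.
by case: iq; apply: val_inj.
Qed.

Lemma standard_pairing_linearl v : scalar (pr^~ v).
Proof.
move=> c u w; rewrite /standard_pairing /= lfunE /= lfunE /= mulrBr mulr_sumr.
rewrite addrACA -opprD -big_split; congr (_ - _); apply: eq_bigr => n _ /=.
by rewrite linearP linearP /= mulrDr mulrCA.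
Qed.

Lemma standard_pairing_linearr v : scalar (pr v).
Proof.
move=> c u w; rewrite /standard_pairing /= linearP /= mulrBr mulr_sumr.
rewrite addrACA -opprD -big_split; congr (_ - _); apply: eq_bigr => n _ /=.
by rewrite lfunE /= lfunE /= mulrDr mulrCA.
Qed.

(** Pairing with the basis of B reads off the coordinates in A^v here, and those
    in A, up to sign, in [standard_pairing_inV]. *)
Lemma standard_pairing_inA v (a : A) : pr v (inA _ a) = (v.2 a : K).
Proof.
by rewrite /standard_pairing /= big1 ?subr0 // => n _; rewrite lfunE mulr0.
Qed.

Lemma standard_pairing_inV v z : pr v (inV _ (dvec z : gshift (gdual A) (1 - d))) =
  - ((-1) ^ ((bdeg z - 1) * (d - 2 - bdeg z)) * (dvec z v.1 : K)).
Proof.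
rewrite /standard_pairing /= linear0 sub0r (bigD1 (tag z)) //= big1 ?addr0.
  by rewrite !dvecE /= (gproj_part _ (gproj_mem _ _)) eqxx.
move=> n nz; rewrite (dvec_homog (gproj_mem n _)) ?mulr0 //.
by apply: contra nz => /eqP zn; apply/eqP/val_inj.
Qed.

Lemma standard_pairing_degree (u v : gelt B) : homog u -> homog v ->
  u.1 + v.1 != d - 1 -> (u.2.2 v.2.1 : K) = 0.
Proof.
rewrite /homog !mem_gsum => /andP[_ u2] /andP[v1 _] uv.
move/mem_gdual: u2; apply; last exact: v1.
apply: contra uv => /eqP ->; apply/eqP; ring.
Qed.

Lemma standard_pairingP : is_pairing (d - 1) pr.
Proof.
split.
- exact: standard_pairing_linearl.
- exact: standard_pairing_linearr.
- move=> u v hu hv uv; have := hu; rewrite /homog mem_gsum => /andP[u1 _].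
  rewrite (standard_pairing_homog _ u1) standard_pairing_degree //.
  by rewrite standard_pairing_degree ?mulr0 ?subr0 // addrC.
- move=> u v hu hv; have := hu; rewrite /homog mem_gsum => /andP[u1 _].
  have := hv; rewrite /homog mem_gsum => /andP[v1 _].
  rewrite (standard_pairing_homog _ u1) (standard_pairing_homog _ v1).
  have [uv|uv] := eqVneq (u.1 + v.1) (d - 1); last first.
    by rewrite !standard_pairing_degree ?mulr0 ?subr0 ?mulr0 ?oppr0 // addrC.
  have dE : d = u.1 + v.1 + 1 by rewrite uv subrK.
  set s := (-1) ^ ((u.1 - 1) * (v.1 - 1)).
  have -> : (-1) ^ ((u.1 - 1) * (d - 2 - u.1)) = s :> K.
    by apply: sign_congr; apply: parity_eq; rewrite dE !oddzE; truth_table.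
  have -> : (-1) ^ ((v.1 - 1) * (d - 2 - v.1)) = s :> K.
    by apply: sign_congr; apply: parity_eq; rewrite dE !oddzE; truth_table.
  have ss : s * s = 1 by rewrite /s exprN1z -signr_addb addbb.
  by rewrite mulrBr opprB mulrA ss mul1r.
move=> v v0; have v2 x : (v.2 (bvec x) : K) = 0 by rewrite -standard_pairing_inA.
have v1 x : (dvec x v.1 : K) = 0.
  apply/eqP; have := v0 (inV _ (dvec x : gshift (gdual A) (1 - d))).
  rewrite standard_pairing_inV => /eqP; rewrite oppr_eq0 mulf_eq0 => /orP[|//].
  by rewrite exprN1z signr_eq0.
move: v1 v2; case: v {v0} => a f /= v1 v2; congr pair.
  by rewrite [a]basis_expand big1 // => x _; rewrite v1 scale0r.
rewrite [f in LHS](dual_expand (f : 'Hom(A, K^o))) big1 // => x _.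
by rewrite v2 scale0r.
Qed.
End Pairing.

(** * Words, cuts and rotations *)

Section Words.
Context (X Y : Type).
Implicit Types (c pre post : seq (seq X)) (a x y : seq X) (o : seq Y)
  (u v w : seq (X + Y)).

(** The legs a^1 f_2 a^2 ... f_k a^k of a vertex, without the first output f_1
    that closes the cyclic word; hence there is one group more than there are
    outputs. *)
Fixpoint weave c o : seq (X + Y) :=
  if c is a :: c' then
    map inl a ++ (if o is y :: o' then inr y :: weave c' o' else [::])
  else [::].

Fixpoint groups w : seq (seq X) :=
  match w with
  | [::] => [:: [::]]
  | inl a :: w' => (a :: head [::] (groups w')) :: behead (groups w')
  | inr _ :: w' => [::] :: groups w'
  end.

Fixpoint duals w : seq Y :=
  match w with
  | [::] => [::]
  | inl _ :: w' => duals w'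
  | inr y :: w' => y :: duals w'
  end.

Lemma size_groups w : size (groups w) = (size (duals w)).+1.
Proof.
elim: w => [|[a|y] w IH] //=; last by rewrite IH.
by rewrite size_behead IH.
Qed.

Lemma groups_cons w : groups w = head [::] (groups w) :: behead (groups w).
Proof. by have := size_groups w; case: groups. Qed.

Lemma groups_cat_inl a w :
  groups (map inl a ++ w) = (a ++ head [::] (groups w)) :: behead (groups w).
Proof. by elim: a => [|x a IH] /=; rewrite -?groups_cons ?IH. Qed.

Lemma groups_cat_inr u (b : Y) v : groups (u ++ inr b :: v) = groups u ++ groups v.
Proof. by elim: u => [|[a|z] u IH] //=; rewrite IH // (groups_cons u). Qed.

Lemma groups_inl a : groups (map inl a : seq (X + Y)) = [:: a].
Proof. by rewrite -[map _ _]cats0 groups_cat_inl /= cats0. Qed.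

Lemma duals_cat u v : duals (u ++ v) = duals u ++ duals v.
Proof. by elim: u => [|[a|y] u IH] //=; rewrite IH. Qed.

Lemma duals_inl a : duals (map inl a) = [::].
Proof. by elim: a. Qed.

Lemma weave_groups w : weave (groups w) (duals w) = w.
Proof.
elim: w => [|[a|y] w IH] //=; last by rewrite IH.
by rewrite -[in RHS]IH [in RHS]groups_cons.
Qed.

Lemma groups_weave c o : size c = (size o).+1 -> groups (weave c o) = c.
Proof.
elim: c o => [//|a c IH] [|y o] /= [] => [/size0nil ->|so].
  by rewrite groups_cat_inl /= cats0.
by rewrite groups_cat_inl /= cats0 IH.
Qed.

Lemma duals_weave c o : size c = (size o).+1 -> duals (weave c o) = o.
Proof.
elim: c o => [//|a c IH] [|y o] /= [] => [_|so].
  by rewrite cats0 duals_inl.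
by rewrite duals_cat duals_inl /= IH.
Qed.

(** An input sits in one slot of one group, and the rest of the family does not
    depend on it: linearity passes between words and families of groups. *)
Lemma groups_split u v : exists (c1 : seq (seq X)) (s1 s2 : seq X) (c2 : seq (seq X)), forall a : X,
  groups (u ++ inl a :: v) = c1 ++ (s1 ++ a :: s2) :: c2.
Proof.
elim: u => [|[b|y] u [c1 [s1 [s2 [c2 E]]]]].
- by exists [::], [::], (head [::] (groups v)), (behead (groups v)).
- case: c1 E => [|h c1] E.
    by exists [::], (b :: s1), s2, c2 => a; rewrite /= E.
  by exists ((b :: h) :: c1), s1, s2, c2 => a; rewrite /= E.
by exists ([::] :: c1), s1, s2, c2 => a; rewrite /= E.
Qed.

Lemma weave_cat pre x y post o1 o2 : size pre = size o1 ->
  weave (rcons pre x) o1 ++ weave (y :: post) o2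
  = weave (pre ++ (x ++ y) :: post) (o1 ++ o2).
Proof.
elim: pre o1 => [|g pre IH] [|z o1] //= => [_|[so]].
  by rewrite cats0 map_cat catA.
by rewrite -catA /= -IH.
Qed.

Lemma weave_cat_inl pre x b y post o1 o2 : size pre = size o1 ->
  weave (rcons pre x) o1 ++ inl b :: weave (y :: post) o2
  = weave (pre ++ (x ++ b :: y) :: post) (o1 ++ o2).
Proof. by move=> so; rewrite -weave_cat. Qed.

Lemma weave_cat_inr pre x b y post o1 o2 : size pre = size o1 ->
  weave (rcons pre x) o1 ++ inr b :: weave (y :: post) o2
  = weave (pre ++ x :: y :: post) (o1 ++ b :: o2).
Proof.
move=> so; have := weave_cat x [::] (y :: post) (b :: o2) so.
by rewrite cats0.
Qed.
End Words.

Section WordMap.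
Context (X X' Y Y' : Type) (f : X -> X') (g : Y -> Y').
Definition map_letter (l : X + Y) : X' + Y' :=
  match l with inl a => inl (f a) | inr y => inr (g y) end.

Lemma groups_map w : groups (map map_letter w) = map (map f) (groups w).
Proof.
elim: w => [|[a|y] w IH] //=; rewrite IH //.
by rewrite (groups_cons w).
Qed.

Lemma duals_map w : duals (map map_letter w) = map g (duals w).
Proof. by elim: w => [|[a|y] w IH] //=; rewrite IH. Qed.

Lemma map_weave c o : map map_letter (weave c o) = weave (map (map f) c) (map g o).
Proof.
elim: c o => //= a c IH o; rewrite map_cat -!map_comp; congr cat.
by case: o => //= y o; rewrite IH.
Qed.
End WordMap.

Section Cuts.
Context (V : nmodType).

(** Sum over the factorizations of a word.  Unlike a sum over positions, it
    distributes over concatenation. *)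
Fixpoint cuts (T : Type) (w : seq T) (F : seq T -> seq T -> V) : V :=
  F [::] w + (if w is x :: w' then cuts w' (fun p q => F (x :: p) q) else 0).

Lemma cutsE T (w : seq T) F :
  cuts w F = \sum_(i < (size w).+1) F (take i w) (drop i w).
Proof.
elim: w F => [|x w IH] F /=; first by rewrite big_ord1 addr0.
by rewrite big_ord_recl /= IH.
Qed.

Lemma eq_cuts T (w : seq T) F G : (forall p q, w = p ++ q -> F p q = G p q) ->
  cuts w F = cuts w G.
Proof.
by move=> FG; rewrite !cutsE; apply: eq_bigr => i _; rewrite FG // cat_take_drop.
Qed.

Lemma cuts_cat T (u v : seq T) x F : cuts (u ++ x :: v) F =
  cuts u (fun p q => F p (q ++ x :: v)) + cuts v (fun p q => F (u ++ x :: p) q).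
Proof.
elim: u F => [|y u IH] F /=; first by rewrite addr0.
by rewrite IH addrA.
Qed.

Lemma cuts_rcons T (u : seq T) x F : cuts (rcons u x) F =
  cuts u (fun p q => F p (rcons q x)) + F (rcons u x) [::].
Proof.
rewrite -cats1 cuts_cat /= addr0; congr (_ + _).
by apply: eq_cuts => p q _; rewrite cats1.
Qed.

Lemma cuts_map T T' (f : T -> T') (w : seq T) F :
  cuts (map f w) F = cuts w (fun p q => F (map f p) (map f q)).
Proof. by elim: w F => //= x w IH F; rewrite IH. Qed.

(** A cut of a vertex falls into exactly one angle. *)
Lemma cuts_weave X Y (c : seq (seq X)) (o : seq Y) F : size c = (size o).+1 ->
  cuts (weave c o) F = \sum_(n < size c) cuts (nth [::] c n) (fun x y =>
    F (weave (rcons (take n c) x) (take n o)) (weave (y :: drop n.+1 c) (drop n o))).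
Proof.
elim: c o F => [//|a c IH] [|b o] F /= [].
  move/size0nil => ->; rewrite big_ord1 /= cats0 cuts_map.
  by apply: eq_cuts => p q _; rewrite !cats0.
move=> so; rewrite big_ord_recl cuts_cat cuts_map IH //; congr (_ + _).
by apply: eq_cuts => p q _; rewrite /= drop0 cats0.
Qed.
End Cuts.

Lemma cuts_sum (T : Type) (t : seq T) (W V : nmodType) (f : W -> V)
  (f0 : f 0 = 0) (fD : {morph f : u v / u + v}) G :
  f (cuts t G) = cuts t (fun u v => f (G u v)).
Proof. by rewrite !cutsE; exact: (big_morph f fD f0). Qed.

Lemma cutsD (T : Type) (t : seq T) (W : nmodType) (G H : seq T -> seq T -> W) :
  cuts t (fun u v => G u v + H u v) = cuts t G + cuts t H.
Proof. by rewrite !cutsE -big_split. Qed.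

Lemma cuts_linear (R : pzRingType) (T : Type) (V W : lmodType R) (w : seq T)
    (G : V -> seq T -> seq T -> W) :
  (forall p q, linear (fun x => G x p q)) -> linear (fun x => cuts w (G x)).
Proof.
move=> lG c x y; rewrite !cutsE scaler_sumr -big_split; apply: eq_bigr => i _.
exact: lG.
Qed.

Lemma sum_shift (V : nmodType) (n i : nat) (F : nat -> V) : (i <= n)%N ->
  \sum_(j < n.+1 | (i <= j)%N) F j = \sum_(j < (n - i).+1) F (i + j)%N.
Proof.
move=> le_in; rewrite -(big_mkord (fun j => i <= j)%N F).
rewrite -(big_mkord xpredT (fun j => F (i + j)%N)) big_mkcond /=.
rewrite (big_cat_nat (n := i)) ?leqW //= [X in X + _]big1_seq ?add0r; last first.
  by move=> j; rewrite mem_index_iota => /andP[_]; case: leqP.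
rewrite -{1}[i]add0n big_addn subSn //; apply: eq_bigr => j _.
by rewrite leq_addl addnC.
Qed.

Section Gerstenhaber.
Context (K : fieldType) (B : gradedSpace K) (mu : seq B -> B).

Definition gerst_term (p q r : seq (gelt B)) : B :=
  (-1) ^ sbar p *: mu (vecs p ++ mu (vecs q) :: vecs r).

Lemma gerstenhaber_cuts s :
  gerstenhaber 1 mu mu s = cuts s (fun p r => cuts r (fun q r' => gerst_term p q r')).
Proof.
rewrite /gerstenhaber cutsE; apply: eq_bigr => i _.
have le_i : (i <= size s)%N by rewrite -ltnS.
rewrite (sum_shift (fun j => (-1) ^ (1 * sbar (take i s)) *:
  mu (vecs (take i s) ++ mu (vecs (drop i (take j s))) :: vecs (drop j s)))) //.
rewrite cutsE size_drop; apply: eq_bigr => j _.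
by rewrite /gerst_term mul1r take_drop drop_drop addnC.
Qed.
End Gerstenhaber.

Section Rotation.
Context (K : fieldType) (B : gradedSpace K).
Implicit Types (s u v w : seq (gelt B)).

Lemma vecs_cat u v : vecs (u ++ v) = vecs u ++ vecs v.
Proof. exact: map_cat. Qed.

Lemma vecs_rcons u x : vecs (rcons u x) = rcons (vecs u) x.2.
Proof. exact: map_rcons. Qed.

Lemma sbar_cat u v : sbar (u ++ v) = sbar u + sbar v.
Proof. exact: big_cat. Qed.

Lemma sbar_cons x u : sbar (x :: u) = x.1 - 1 + sbar u.
Proof. exact: big_cons. Qed.

Lemma sbar_nil : sbar ([::] : seq (gelt B)) = 0.
Proof. exact: big_nil. Qed.

Lemma sbar_rcons u x : sbar (rcons u x) = sbar u + (x.1 - 1).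
Proof. by rewrite -cats1 sbar_cat sbar_cons sbar_nil addr0. Qed.

(** Rotating letter by letter accumulates the Koszul sign of the whole block. *)
Lemma rotate_cat (T : seq (gelt B) -> K) :
  (forall x w, homog x -> all (@homog K B) w ->
    T (x :: w) = (-1) ^ ((x.1 - 1) * sbar w) * T (rcons w x)) ->
  forall u v, all (@homog K B) u -> all (@homog K B) v ->
  T (u ++ v) = (-1) ^ (sbar u * sbar v) * T (v ++ u).
Proof.
move=> rot1; elim=> [|x u IH] v; first by rewrite sbar_nil cats0 mul0r expr0z mul1r.
rewrite [all _ _]/= => /andP[hx hu] hv; rewrite cat_cons.
rewrite rot1 ?all_cat ?hu // rcons_cat IH ?all_rcons ?hx // mulrA sign_mul cat_rcons.
congr (_ * _).
apply: sign_congr; apply: parity_eq; rewrite sbar_cat sbar_cons sbar_rcons !oddzE.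
truth_table.
Qed.

Context (pr : B -> B -> K) (mu : seq B -> B).

(** The cyclic tensor of [mu]: the last entry is the one that is paired. *)
Definition cyc (s : seq B) : K :=
  if s is x :: t then pr (mu (belast x t)) (last x t) else 0.

Lemma cyc_rcons (s : seq B) z : cyc (rcons s z) = pr (mu s) z.
Proof. by case: s => //= x t; rewrite belast_rcons last_rcons. Qed.

Definition cyclic_inv := forall (x z : gelt B) (s : seq (gelt B)),
    homog x -> homog z -> all (@homog K B) s ->
    pr (mu (x.2 :: vecs s)) z.2 =
      (-1) ^ ((x.1 - 1) * sbar (rcons s z)) * pr (mu (rcons (vecs s) z.2)) x.2.

Hypothesis mu_cyc : cyclic_inv.

Lemma cyc_rot u v : all (@homog K B) u -> all (@homog K B) v ->
  cyc (vecs (u ++ v)) = (-1) ^ (sbar u * sbar v) * cyc (vecs (v ++ u)).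
Proof.
move=> hu hv; apply: (rotate_cat (T := fun w => cyc (vecs w))) => // x w hx.
case/lastP: w => [|s z]; first by rewrite sbar_nil mulr0 expr0z mul1r.
rewrite all_rcons => /andP[hz hs].
rewrite -rcons_cons /vecs map_rcons cyc_rcons map_rcons cyc_rcons map_rcons.
exact: mu_cyc.
Qed.
End Rotation.

(** * Signs of the glued trees *)

(** A general identity, so that [ring] never meets the exponents. *)
Lemma gather_signs (R : comUnitRingType) s1 s2 s3 s4 (M1 M2 : R) :
  (-1) ^ s1 * (((-1) ^ s2 * ((-1) ^ s3 * M1)) * ((-1) ^ s4 * M2))
  = (-1) ^ (s1 + (s2 + (s3 + s4))) * (M1 * M2).
Proof.
rewrite -!sign_mul; move: (_ ^ s1) (_ ^ s2) (_ ^ s3) (_ ^ s4) => a b c e; ring.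
Qed.

Section DegreeWords.
Implicit Types (u v w : seq (int + int)) (l : int + int).

(** Words are now reduced to degrees: an input contributes its degree in A[1],
    and a dual letter e^x contributes the degree of x in A[1].  The letter e^x
    itself has degree d - 3 minus that, so the signs below depend on the number
    of dual letters as well. *)
Definition in_bar w : int := \sum_(l <- w) (if l is inl a then a else 0).
Definition out_bar w : int := \sum_(l <- w) (if l is inr x then x else 0).
Definition out_num w : int := \sum_(l <- w) (if l is inr _ then 1 else 0).

(** With D = d - 1, this is the sum of a x over the inputs a standing before an
    output x, of (x + D) y over the outputs x before y, and of D a over the
    outputs standing before an input a. *)
Fixpoint word_sign (D : int) w : int :=
  match w with
  | [::] => 0
  | inl a :: w' => a * out_bar w' + word_sign D w'
  | inr x :: w' => (x + D) * out_bar w' + D * in_bar w' + word_sign D w'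
  end.

Lemma in_bar_cat u v : in_bar (u ++ v) = in_bar u + in_bar v. Proof. exact: big_cat. Qed.
Lemma out_bar_cat u v : out_bar (u ++ v) = out_bar u + out_bar v. Proof. exact: big_cat. Qed.
Lemma out_num_cat u v : out_num (u ++ v) = out_num u + out_num v. Proof. exact: big_cat. Qed.
Lemma in_bar_inl a v : in_bar (inl a :: v) = a + in_bar v. Proof. exact: big_cons. Qed.
Lemma in_bar_inr x v : in_bar (inr x :: v) = in_bar v. Proof. by rewrite /in_bar big_cons add0r. Qed.
Lemma out_bar_inl a v : out_bar (inl a :: v) = out_bar v. Proof. by rewrite /out_bar big_cons add0r. Qed.
Lemma out_bar_inr x v : out_bar (inr x :: v) = x + out_bar v. Proof. exact: big_cons. Qed.
Lemma out_num_inl a v : out_num (inl a :: v) = out_num v. Proof. by rewrite /out_num big_cons add0r. Qed.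
Lemma out_num_inr x v : out_num (inr x :: v) = 1 + out_num v. Proof. exact: big_cons. Qed.
Lemma in_bar_nil : in_bar [::] = 0. Proof. exact: big_nil. Qed.
Lemma out_bar_nil : out_bar [::] = 0. Proof. exact: big_nil. Qed.
Lemma out_num_nil : out_num [::] = 0. Proof. exact: big_nil. Qed.

Definition wordE := (in_bar_cat, out_bar_cat, out_num_cat, in_bar_inl, in_bar_inr, out_bar_inl, out_bar_inr,
  out_num_inl, out_num_inr, in_bar_nil, out_bar_nil, out_num_nil).

(** The cocycle rule that reduces every comparison of signs to the degrees of the
    pieces of a word. *)
Lemma word_sign_cat D u v :
  word_sign D (u ++ v) = word_sign D u + word_sign D v
    + (out_bar u + in_bar u + D * out_num u) * out_bar v + D * out_num u * in_bar v.
Proof.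
elim: u => [|[a|x] u IH] /=; rewrite ?wordE ?IH; ring.
Qed.

(** The sign between the tensor of mu on the word w x and the coefficient of m.
    If d is odd it is the Koszul sign of moving the outputs in w in front of the
    inputs and reversing the order of all outputs, times the sign given by the
    total degree of the outputs.  The
    multiples of d - 1 absorb both the shift between the degrees of e^x and of x
    and the sign (d - 1)(k - 1) in the action of Z_k. *)
Definition corr_sign (d : int) w (x : int) : int :=
  word_sign (d - 1) w + x * out_bar w + ((d - 1) * out_num w + d) * (out_bar w + x).

(** The common ratio of all terms of the Gerstenhaber square and of the necklace
    square; it is the existence of such a ratio that makes the two relations
    equivalent. *)
Definition relation_sign (d : int) w (x : int) : int :=
  word_sign (d - 1) w + 1 + x * out_bar w + d * x
  + (d - 1) * (out_bar w + out_num w * (out_bar w + x)).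
End DegreeWords.

Section Letters.
Context (K : fieldType) (A : gradedSpace K) (d : int).
Local Notation B := (dual_double A d).
Local Notation pr := (@standard_pairing K A d).
Definition letter : Type := (gelt A + bidx A)%type.
Implicit Types (w p q r : seq letter) (x y z : bidx A) (l : letter).

Definition dual_basis_vec x : B := inV _ (dvec x : gshift (gdual A) (1 - d)).

Definition letter_elt l : gelt B :=
  match l with
  | inl g => (g.1, inA _ g.2)
  | inr x => (d - 1 - bdeg x, dual_basis_vec x)
  end.

Definition letter_bar l : int + int :=
  match l with inl g => inl (g.1 - 1) | inr x => inr (bdeg x - 1) end.

Definition homog_letter l : bool := if l is inl g then homog g else true.

Definition word_elts w : seq (gelt B) := map letter_elt w.
Definition bars w : seq (int + int) := map letter_bar w.

Arguments word_elts : simpl never.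
Arguments bars : simpl never.

Lemma elts_cat u v : word_elts (u ++ v) = word_elts u ++ word_elts v. Proof. exact: map_cat. Qed.
Lemma bars_cat u v : bars (u ++ v) = bars u ++ bars v. Proof. exact: map_cat. Qed.
Lemma bars_inl g v : bars (inl g :: v) = inl (g.1 - 1) :: bars v. Proof. by []. Qed.
Lemma bars_inr x v : bars (inr x :: v) = inr (bdeg x - 1) :: bars v. Proof. by []. Qed.
Lemma bars_nil : bars [::] = [::]. Proof. by []. Qed.
Lemma elts_rcons w l : word_elts (rcons w l) = rcons (word_elts w) (letter_elt l).
Proof. exact: map_rcons. Qed.
Lemma elts_cons l w : word_elts (l :: w) = letter_elt l :: word_elts w. Proof. by []. Qed.
Lemma elts_inl g v : word_elts (inl g :: v) = (g.1, inA _ g.2) :: word_elts v. Proof. by []. Qed.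
Lemma elts_inr x v : word_elts (inr x :: v) = (d - 1 - bdeg x, dual_basis_vec x) :: word_elts v. Proof. by []. Qed.
Definition barsE := (bars_cat, bars_inl, bars_inr, bars_nil).

Lemma letter_homog l : homog_letter l -> homog (letter_elt l).
Proof.
case: l => [g|x] /=; rewrite /homog mem_gsum /= ?mem0v ?andbT //.
by move=> _; exact: dvec_mem.
Qed.

Lemma elts_homog w : all homog_letter w -> all (@homog K B) (word_elts w).
Proof. by move/allP => h; apply/allP => _ /mapP[l /h hl ->]; exact: letter_homog. Qed.

Lemma sbar_elts_rcons w l : sbar (word_elts (rcons w l)) = sbar (word_elts w) + ((letter_elt l).1 - 1).
Proof. by rewrite elts_rcons sbar_rcons. Qed.

Lemma sbar_elts w :
  sbar (word_elts w) = in_bar (bars w) + (d - 3) * out_num (bars w) - out_bar (bars w).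
Proof.
elim: w => [|[g|x] w IH]; first by rewrite sbar_nil barsE !wordE; ring.
  by rewrite elts_inl sbar_cons IH barsE !wordE /=; ring.
by rewrite elts_inr sbar_cons IH barsE !wordE /=; ring.
Qed.

Lemma out_bar_bars w : out_bar (bars w) = obar (duals w).
Proof.
rewrite /obar; elim: w => [|[g|x] w IH] /=; rewrite ?barsE ?wordE ?IH ?big_nil ?big_cons //.
Qed.

Lemma out_num_bars w : out_num (bars w) = (size (duals w))%:Z.
Proof. by elim: w => [|[g|x] w IH] /=; rewrite ?barsE ?wordE ?IH //. Qed.

Lemma in_bar_bars w : in_bar (bars w) = sbar (flatten (groups w)).
Proof.
elim: w => [|[g|x] w IH] /=; rewrite ?barsE ?wordE ?IH ?sbar_nil //.
by rewrite [in LHS](groups_cons w) /= sbar_cons.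
Qed.

Lemma sbar_elts_inl (a : seq (gelt A)) : sbar (word_elts (map inl a)) = sbar a.
Proof.
elim: a => [|g a IH]; first by rewrite !sbar_nil.
by rewrite sbar_cons -IH; exact: (sbar_cons (letter_elt (inl g)) (word_elts (map inl a))).
Qed.

Lemma in_bar_bars_inl (a : seq (gelt A)) : in_bar (bars (map inl a)) = sbar a.
Proof.
elim: a => [|g a IH]; first by rewrite sbar_nil barsE wordE.
by rewrite sbar_cons -IH; exact: in_bar_inl.
Qed.

Lemma out_bar_bars_inl (a : seq (gelt A)) : out_bar (bars (map inl a)) = 0.
Proof. by rewrite out_bar_bars duals_inl /obar big_nil. Qed.

Lemma out_num_bars_inl (a : seq (gelt A)) : out_num (bars (map inl a)) = 0.
Proof. by rewrite out_num_bars duals_inl. Qed.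

Lemma word_sign_inl (a : seq (gelt A)) D : word_sign D (bars (map inl a)) = 0.
Proof.
elim: a => //= g a ->; rewrite addr0 out_bar_bars duals_inl /obar big_nil mulr0 //.
Qed.

(** The correspondence in the form used throughout: on homogeneous inputs and
    basis functionals, with the first output as the last letter. *)
Definition word_corr (m : cochain A) (mu : seq B -> B) : Prop :=
  forall w x, all homog_letter w ->
    pr (mu (vecs (word_elts w))) (dual_basis_vec x)
    = (-1) ^ corr_sign d (bars w) (bdeg x - 1)
      * m (map (@vecs K A) (groups w)) (x :: duals w).
End Letters.

(** The degree condition by itself, since the sign comparisons use nothing else
    about m and it is available before m is known to be a cochain. *)
Definition degree_law (K : fieldType) (A : gradedSpace K) (d : int) (m : cochain A) :=
  forall (c : seq (seq (gelt A))) o,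
  all (all (@homog K A)) c -> m (map (@vecs K A) c) o != 0 ->
  \sum_(x <- o) bdeg x = sbar (flatten c) + 2 + (d - 2) * ((size c)%:Z - 1).

Section EdgeSigns.
Context (K : fieldType) (A : gradedSpace K) (d : int).
Local Notation B := (dual_double A d).
Local Notation pr := (@standard_pairing K A d).
Local Notation letter := (letter A).
Context (m : cochain A) (mu : seq B -> B).
Hypothesis m_degree : degree_law d m.
Hypothesis mu_cyc : cyclic_inv pr mu.
Hypothesis corr : word_corr m mu.
Implicit Types (w p q r : seq letter) (x y z : bidx A).
Local Notation elts := (@word_elts K A d).
Local Notation dualv := (@dual_basis_vec K A d).
Local Notation mw w o := (m (map (@vecs K A) (groups w)) o).

Lemma all_homog_groups w : all (@homog_letter K A) w ->
  all (all (@homog K A)) (groups w).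
Proof.
elim: w => [|[g|x] w IH] //= /andP[hg /IH]; rewrite (groups_cons w) /=.
by case/andP => -> ->; rewrite hg.
Qed.

Lemma word_degree w x : all (@homog_letter K A) w -> mw w (x :: duals w) != 0 ->
  bdeg x + out_bar (bars w) = in_bar (bars w) + 2 + (d - 3) * out_num (bars w).
Proof.
move=> hw /(m_degree (all_homog_groups hw)).
rewrite -in_bar_bars size_groups big_cons => E.
have -> : out_bar (bars w) = \sum_(y <- duals w) bdeg y - out_num (bars w).
  rewrite out_bar_bars out_num_bars /obar; elim: (duals w) => [|y o IH].
    by rewrite !big_nil subr0.
  by rewrite !big_cons IH /= intS; ring.
rewrite addrA E out_num_bars intS; ring.
Qed.

Lemma word_parity w x : all (@homog_letter K A) w -> mw w (x :: duals w) != 0 ->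
  oddz (out_bar (bars w) + in_bar (bars w) + (bdeg x - 1) + (d - 1) * out_num (bars w) + 1) = false.
Proof.
move=> hw m0; have -> : out_bar (bars w) = in_bar (bars w) + 2 + (d - 3) * out_num (bars w) - bdeg x.
  by rewrite -(word_degree hw m0); ring.
have -> : forall n a b : int,
   a + 2 + (d - 3) * n - b + a + (b - 1) + (d - 1) * n + 1 = 2 * (a + (d - 2) * n + 1) + 0.
  by move=> n a b; ring.
by rewrite !oddzE.
Qed.

(** The exponent in [necP], read off the factorization w = p q r: the inner
    vertex has the l - 1 outputs of q, and n is one more than the number of
    outputs of p. *)
Definition necP_sign p q r : int :=
  let l := (size (duals q)).+1 in
  let k := (size (duals p) + size (duals r)).+1 in
  let n := (size (duals p)).+1 in
  (l%:Z - 1) * (d - 1) * (k%:Z - n%:Z + 2 + 1)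
  + opbar d 2 l * in_bar (bars p)
  + out_bar (bars q) * in_bar (bars r) + out_bar (bars q) * out_bar (bars r).

(** The summand of <mu(p, mu(q), r), x> in which mu(q) contributes its component
    along [bvec z]: the edge runs from the vertex of q to that of p, r, x.  The
    coordinate along [bvec z] is a pairing with e^z, so both factors are values
    of m, and their degree constraints determine all that the comparison of
    signs needs. *)
Lemma inner_output_in_A p q r x z :
  all (@homog_letter K A) p -> all (@homog_letter K A) q -> all (@homog_letter K A) r ->
  (-1) ^ sbar (elts p) * ((dvec z (mu (vecs (elts q))).1 : K)
     * pr (mu (vecs (elts (p ++ inl (belt z) :: r)))) (dualv x))
  = (-1) ^ relation_sign d (bars (p ++ q ++ r)) (bdeg x - 1) *
    ((-1) ^ necP_sign p q r * mw q (z :: duals q)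
     * mw (p ++ inl (belt z) :: r) (x :: duals (p ++ r))).
Proof.
move=> hp hq hr; set w := p ++ inl (belt z) :: r.
have hw : all (@homog_letter K A) w.
  by rewrite all_cat hp /= hr /homog bvec_homog.
have -> : duals (p ++ r) = duals w by rewrite !duals_cat.
have -> : dvec z (mu (vecs (elts q))).1 =
    (-1) ^ (1 + (bdeg z - 1) * (d - 2 - bdeg z)) * pr (mu (vecs (elts q))) (dualv z) :> K.
  rewrite standard_pairing_inV -sign_mul expr1z mulN1r mulrNN mulrA exprN1z.
  by rewrite -signr_addb addbb mul1r.
rewrite !corr //.
have [->|m1] := eqVneq (mw q (z :: duals q)) 0; first by rewrite !(mulr0, mul0r).
have [->|m2] := eqVneq (mw w (x :: duals w)) 0; first by rewrite !(mulr0, mul0r).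
have P1 := word_parity hq m1; have P2 := word_parity hw m2.
move: (mw q _) (mw w _) => M1 M2.
set s1 := sbar _; set s2 := 1 + _; set s3 := corr_sign _ _ _.
set s4 := corr_sign _ _ _; set s5 := relation_sign _ _ _; set s6 := necP_sign _ _ _.
rewrite gather_signs -!mulrA [in RHS]mulrA sign_mul.
congr (_ * _); apply: sign_congr; move: P1 P2; apply: parity_eq_if2.
rewrite /s1 /s2 /s3 /s4 /s5 /s6 /w /relation_sign /corr_sign /necP_sign /opbar.
rewrite sbar_elts !barsE !wordE !word_sign_cat /= !wordE.
rewrite !intS !PoszD -!out_num_bars.
by rewrite !oddzE; truth_table.
Qed.

(** The exponent in [necR], for q = y x' q': the inputs y stand before the first
    output x' of the inner vertex. *)
Definition necR_sign p (y : seq (gelt A)) (x' : bidx A) q' r (x z : bidx A) : int :=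
  let k := (size (duals q')).+1 in
  let l := (size (duals p) + size (duals r)).+2 in
  let n := (size (duals p)).+1 in
  let yFx := sbar y + in_bar (bars q') in
  (l%:Z - 1) * (d - 1) * (2 + 1) + (k%:Z - 1) * (d - 1) * n%:Z
  + yFx * in_bar (bars r) + out_bar (bars r) * yFx
  + (bdeg z - 1 + sbar y) * in_bar (bars q')
  + opbar d 2 k * (bdeg x - 1 + out_bar (bars p)).

(** The summand in which mu(q) contributes its component along e^z: the edge runs
    from the vertex of p, r, x to that of q.  The coordinate along e^z is the
    value of the tensor on q [bvec z], a word ending with an input, and it must be
    rotated until the first output x' of q comes last. *)
Lemma inner_output_in_dual p (y : seq (gelt A)) x' q' r x z :
  let q := map inl y ++ inr x' :: q' in
  all (@homog_letter K A) p -> all (@homog_letter K A) q -> all (@homog_letter K A) r ->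
  (-1) ^ sbar (elts p) * (((mu (vecs (elts q))).2 (bvec z) : K)
     * pr (mu (vecs (elts (p ++ inr z :: r)))) (dualv x))
  = (-1) ^ relation_sign d (bars (p ++ q ++ r)) (bdeg x - 1) *
    ((-1) ^ necR_sign p y x' q' r x z * mw (p ++ inr z :: r) (x :: duals p ++ z :: duals r)
     * mw (q' ++ inl (belt z) :: map inl y) (x' :: duals q')).
Proof.
move=> q hp hq hr; set w := p ++ inr z :: r.
set w' := q' ++ _.
have hw : all (@homog_letter K A) w by rewrite all_cat hp /= hr.
move: (hq); rewrite all_cat /= => /andP[hy hq'].
have hz : homog (belt z) by rewrite /homog bvec_homog.
have hw' : all (@homog_letter K A) w' by rewrite all_cat hq' /= hz.
have -> : duals p ++ z :: duals r = duals w by rewrite duals_cat.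
have -> : duals q' = duals w' by rewrite duals_cat /= duals_inl cats0.
have -> : ((mu (vecs (elts q))).2 (bvec z) : K) =
    (-1) ^ ((sbar (elts (map inl y)) + (d - 2 - bdeg x')) *
            (sbar (elts q') + (bdeg z - 1))) * pr (mu (vecs (elts w'))) (dualv x').
  rewrite -standard_pairing_inA -[inA _ (bvec z)]/(letter_elt d (inl (belt z))).2.
  rewrite -[dualv x' in RHS]/(letter_elt d (inr x')).2.
  rewrite -!cyc_rcons -!vecs_rcons -!elts_rcons.
  have -> : rcons q (inl (belt z)) = rcons (map inl y) (inr x') ++ rcons q' (inl (belt z)).
    by rewrite cat_rcons /q rcons_cat.
  rewrite elts_cat cyc_rot //; last 2 first.
  - by apply: elts_homog; rewrite all_rcons.
  - by apply: elts_homog; rewrite all_rcons /= hz.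
  rewrite -elts_cat cat_rcons -rcons_cons -rcons_cat; congr (_ * _); congr (_ ^ _).
  rewrite !elts_rcons !sbar_rcons /=; ring.
rewrite !corr //.
have [->|m1] := eqVneq (mw w' (x' :: duals w')) 0; first by rewrite !(mulr0, mul0r).
have [->|m2] := eqVneq (mw w (x :: duals w)) 0; first by rewrite !(mulr0, mul0r).
have P1 := word_parity hw' m1; have P2 := word_parity hw m2.
move: (mw w' _) (mw w _) => M1 M2.
set s1 := sbar _; set s2 := (_ + _) * _; set s3 := corr_sign _ _ _.
set s4 := corr_sign _ _ _; set s5 := relation_sign _ _ _; set s6 := necR_sign _ _ _ _ _ _ _.
rewrite gather_signs [M1 * M2]mulrC -!mulrA [in RHS]mulrA sign_mul.
congr (_ * _); apply: sign_congr; move: P1 P2; apply: parity_eq_if2.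
rewrite /s1 /s2 /s3 /s4 /s5 /s6 /w /w' /q /relation_sign /corr_sign /necR_sign /opbar.
rewrite !sbar_elts !barsE !wordE !word_sign_cat /= !wordE !word_sign_inl.
rewrite in_bar_bars_inl out_bar_bars_inl out_num_bars_inl.
rewrite !intS !PoszD -!out_num_bars.
by rewrite !oddzE; truth_table.
Qed.
End EdgeSigns.

(** * The necklace square and the Gerstenhaber square *)

Lemma sum_triangle (V : nmodType) (N : nat) (G : nat -> nat -> V) :
  \sum_(0 <= n < N) \sum_(0 <= e < N - n) G n e
  = \sum_(0 <= e < N) \sum_(0 <= n < N - e) G n e.
Proof.
have widen (H : nat -> V) n : \sum_(0 <= e < N - n) H e =
    \sum_(0 <= e < N | (n + e < N)%N) H e.
  rewrite (big_nat_widen _ _ N) ?leq_subr //; apply: eq_bigl => e /=.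
  by rewrite ltn_subRL.
under eq_bigr do rewrite widen.
rewrite (exchange_big_dep_nat xpredT) //=; apply: eq_bigr => e _.
by rewrite widen; apply: eq_bigl => n; rewrite addnC.
Qed.

(** The components (k, l) and the angles n, m against the two cuts of a word: the
    first cut lies in angle n and the second one e angles further. *)
Lemma sum_components (V : nmodType) (N : nat) (f g : nat -> nat -> nat -> V) :
  \sum_(1 <= k < N.+1)
    (\sum_(1 <= n < k.+1) f k (N.+1 - k)%N n
     + \sum_(1 <= n < N.+1 - k) g k (N.+1 - k)%N n)
  = \sum_(0 <= n < N) \sum_(0 <= e < N - n)
    (f (N - e)%N e.+1 n.+1 + (if e is 0 then 0 else g e (N.+1 - e)%N n.+1)).
Proof.
rewrite big_split /=; under [RHS]eq_bigr do rewrite big_split /=.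
rewrite [RHS]big_split /=; congr (_ + _).
  rewrite big_nat_rev /= big_add1 /= sum_triangle; apply: eq_big_nat => e /andP[_ eN].
  rewrite big_add1 /= add1n !subSS.
  by rewrite (_ : (N.+1 - (N - e))%N = e.+1) // subSn ?leq_subr // subKn // ltnW.
rewrite [RHS]sum_triangle; case: N => [|N]; first by rewrite !big_geq.
rewrite [RHS]big_nat_recl // [X in X + _]big1_seq // add0r.
rewrite big_nat_recr //= [X in _ + X]big_geq ?addr0; last by rewrite subSn // subnn.
rewrite big_add1 /=; apply: eq_big_nat => e /andP[_ eN].
rewrite big_add1 /= !subSS subSn //; exact: ltnW.
Qed.

Lemma cut_rcons (T : Type) i j (a b : seq T) F :
  cut i j (a :: rcons F b) = drop i a :: rcons F (take j b).
Proof.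
rewrite /cut /= last_rcons size_rcons /=; congr cons.
by elim: F => //= x F ->.
Qed.

Section NecklaceRelation.
Context (K : fieldType) (A : gradedSpace K) (d : int).
Local Notation B := (dual_double A d).
Local Notation pr := (@standard_pairing K A d).
Local Notation letter := (letter A).
Context (m : cochain A) (mu : seq B -> B).
Hypothesis m_degree : degree_law d m.
Hypothesis mu_cyc : cyclic_inv pr mu.
Hypothesis mu_lin : multilinear mu.
Hypothesis mu_sub : is_subalgebra mu.
Hypothesis corr : word_corr m mu.
Implicit Types (w p q r : seq letter) (x y z : bidx A).
Local Notation elts := (@word_elts K A d).
Local Notation dualv := (@dual_basis_vec K A d).
Local Notation mw w o := (m (map (@vecs K A) (groups w)) o).
Local Notation hom := (all (@homog_letter K A)).

Lemma dual_double_expand (v : B) : v =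
  \sum_z (dvec z v.1 : K) *: (inA _ (bvec z) : B)
  + \sum_z (v.2 (bvec z) : K) *: dualv z.
Proof.
rewrite {1}[v]surjective_pairing.
have -> : (v.1, v.2) = (inA _ v.1 : B) + (inV _ v.2 : B) :> B.
  by congr pair; rewrite /= ?addr0 ?add0r.
congr (_ + _).
  rewrite {1}[v.1]basis_expand (linear_big_sum (@inA_linear _ _ _)).
  by apply: eq_bigr => z _; rewrite (linear_scale (@inA_linear _ _ _)).
rewrite {1}[v.2]dual_expand (linear_big_sum (@inV_linear _ _ _)).
by apply: eq_bigr => z _; rewrite (linear_scale (@inV_linear _ _ _)).
Qed.

Definition necP_term x p q r : K := \sum_z
  (-1) ^ necP_sign d p q r * mw q (z :: duals q)
     * mw (p ++ inl (belt z) :: r) (x :: duals (p ++ r)).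

Definition necR_term x p (y : seq (gelt A)) x' q r : K := \sum_z
  (-1) ^ necR_sign d p y x' q r x z * mw (p ++ inr z :: r) (x :: duals p ++ z :: duals r)
     * mw (q ++ inl (belt z) :: map inl y) (x' :: duals q).

Lemma gerst_term_expand x p q r :
  pr (gerst_term mu (elts p) (elts q) (elts r)) (dualv x) =
  \sum_z (-1) ^ sbar (elts p) * ((dvec z (mu (vecs (elts q))).1 : K)
     * pr (mu (vecs (elts (p ++ inl (belt z) :: r)))) (dualv x))
  + \sum_z (-1) ^ sbar (elts p) * (((mu (vecs (elts q))).2 (bvec z) : K)
     * pr (mu (vecs (elts (p ++ inr z :: r)))) (dualv x)).
Proof.
have lp : linear (pr^~ (dualv x) : B -> K^o) := standard_pairing_linearl _.
have lm := mu_lin (vecs (elts p)) (vecs (elts r)).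
rewrite /gerst_term (linear_scale lp) {1}[mu (vecs (elts q))]dual_double_expand.
rewrite (linear_add lm) !(linear_big_sum lm) (linear_add lp) !(linear_big_sum lp) -[_ *: _]/(_ * _) mulrDr.
rewrite !mulr_sumr; congr (_ + _); apply: eq_bigr => z _; congr (_ * _);
  by rewrite (linear_scale lm) (linear_scale lp) elts_cat vecs_cat.
Qed.

Lemma gerst_term_dual x p (y : seq (gelt A)) x' q r :
  hom p -> hom (map inl y ++ inr x' :: q) -> hom r ->
  pr (gerst_term mu (elts p) (elts (map inl y ++ inr x' :: q)) (elts r)) (dualv x) =
  (-1) ^ relation_sign d (bars (p ++ (map inl y ++ inr x' :: q) ++ r)) (bdeg x - 1)
  * (necP_term x p (map inl y ++ inr x' :: q) r + necR_term x p y x' q r).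
Proof.
move=> hp hq hr; rewrite gerst_term_expand mulrDr !mulr_sumr.
congr (_ + _); apply: eq_bigr => z _; first by rewrite (inner_output_in_A m_degree corr).
by rewrite (inner_output_in_dual m_degree mu_cyc corr).
Qed.

Lemma vecs_elts_inl (a : seq (gelt A)) :
  vecs (elts (map inl a)) = [seq inA _ v | v <- vecs a].
Proof. by rewrite /vecs /word_elts -!map_comp. Qed.

(** A factor q without outputs has no component in A^v, because A is a
    subalgebra: this is why R_m needs an output of the inner vertex. *)
Lemma gerst_term_sub x p (a : seq (gelt A)) r : hom p -> hom (map inl a) -> hom r ->
  pr (gerst_term mu (elts p) (elts (map inl a)) (elts r)) (dualv x) =
  (-1) ^ relation_sign d (bars (p ++ map inl a ++ r)) (bdeg x - 1)
  * necP_term x p (map inl a) r.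
Proof.
move=> hp ha hr; rewrite gerst_term_expand [X in _ + X]big1 ?addr0 => [|z _].
  by rewrite mulr_sumr; apply: eq_bigr => z _; rewrite (inner_output_in_A m_degree corr).
by rewrite vecs_elts_inl mu_sub lfunE mul0r mulr0.
Qed.

Implicit Types (a b : seq (gelt A)) (c g pre post F : seq (seq (gelt A))).

Lemma necP_term_weave x pre a1 oP g oM b2 post oR :
  size pre = size oP -> size g = (size oM).+1 -> size post = size oR ->
  necP_term x (weave (rcons pre a1) oP) (weave g oM) (weave (b2 :: post) oR) =
  \sum_z (-1) ^ (((size oM).+1%:Z - 1) * (d - 1)
                   * ((size oP + size oR).+1%:Z - (size oP).+1%:Z + 2 + 1)
            + opbar d 2 (size oM).+1 * (sbar (flatten pre) + sbar a1)
            + obar oM * (sbar b2 + sbar (flatten post))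
            + obar oM * obar oR)
    * m (map (@vecs K A) g) (z :: oM)
    * m (map (@vecs K A) (pre ++ (a1 ++ belt z :: b2) :: post)) (x :: oP ++ oR).
Proof.
move=> sP sM sR.
have s1 : size (rcons pre a1) = (size oP).+1 by rewrite size_rcons sP.
have s3 : size (b2 :: post) = (size oR).+1 by rewrite /= sR.
have s13 z : size (pre ++ (a1 ++ belt z :: b2) :: post) = (size (oP ++ oR)).+1.
  by rewrite !size_cat /= sP sR addnS.
apply: eq_bigr => z _; rewrite /necP_sign !in_bar_bars !out_bar_bars weave_cat_inl //
  (duals_cat (weave (rcons pre a1) oP)).
rewrite (duals_weave s1) (duals_weave sM) (duals_weave s3) (groups_weave sM).
rewrite (groups_weave s1) (groups_weave s3) (groups_weave (s13 z)).
by rewrite -cats1 !flatten_cat /= !sbar_cat sbar_nil addr0.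
Qed.

(** A summand of P_n is a choice of two cuts, in the angles n and n + l - 1; they
    have to be in order when the two angles coincide. *)
Lemma necP_cuts c o x n e : size c = (size o).+1 -> (n + e < size c)%N ->
  necP d 2 2 m m (size c - e) e.+1 n.+1 c (x :: o) =
  cuts (nth [::] c n) (fun a1 b1 =>
    let c2 := b1 :: drop n.+1 c in
    cuts (nth [::] c2 e) (fun a2 b2 =>
      necP_term x (weave (rcons (take n c) a1) (take n o))
        (weave (rcons (take e c2) a2) (take e (drop n o)))
        (weave (b2 :: drop e.+1 c2) (drop e (drop n o))))).
Proof.
move=> so ne; have sn : (n < size c)%N by apply: leq_ltn_trans ne; exact: leq_addr.
have so1 : (n <= size o)%N by rewrite -ltnS -so.
have so2 : (n + e <= size o)%N by rewrite -ltnS -so.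
have sc2 b1 : size (b1 :: drop n.+1 c) = (size (drop n o)).+1.
  by rewrite /= !size_drop so subSS.
have sP : size (take n c) = size (take n o) by rewrite !size_takel // ltnW.
have sR b1 : size (drop e.+1 (b1 :: drop n.+1 c)) = size (drop e (drop n o)).
  by rewrite /= !size_drop so subSS.
have sM b1 a2 : size (rcons (take e (b1 :: drop n.+1 c)) a2) = (size (take e (drop n o))).+1.
  by rewrite size_rcons !size_takel // ?sc2 size_drop; lia.
pose cn := nth [::] c n; pose ce := nth [::] c (n + e).
pose G i j := \sum_z (-1) ^ ((e.+1%:Z - 1) * (d - 1) * ((size c - e)%N%:Z - n.+1%:Z + 2 + 1)
      + opbar d 2 e.+1 * (sbar (flatten (take n c)) + sbar (take i cn))
      + obar (take e (drop n o)) * (sbar (drop j ce) + sbar (flatten (drop (n + e).+1 c)))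
      + obar (take e (drop n o)) * obar (drop (n + e) o))
    * m (map (@vecs K A) (cut i j (take e.+1 (drop n c)))) (z :: take e (drop n o))
    * m (map (@vecs K A) (take n c ++ (take i cn ++ belt z :: drop j ce) :: drop (n + e).+1 c))
        (x :: take n o ++ drop (n + e) o).
have -> : necP d 2 2 m m (size c - e) e.+1 n.+1 c (x :: o) =
    \sum_(i < (size cn).+1) \sum_(j < (size ce).+1 | (e == 0)%N ==> (i <= j)%N) G i j.
  rewrite /necP (_ : (n.+1 + e.+1 - 2 = n + e)%N); last by lia.
  by rewrite (_ : (n.+1 + e.+1 - 1 = (n + e).+1)%N) //; lia.
have GT i j a2 b2 : cut i j (take e.+1 (drop n c)) =
      rcons (take e (drop i cn :: drop n.+1 c)) a2 -> drop j ce = b2 ->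
    G i j = necP_term x (weave (rcons (take n c) (take i cn)) (take n o))
      (weave (rcons (take e (drop i cn :: drop n.+1 c)) a2) (take e (drop n o)))
      (weave (b2 :: drop e.+1 (drop i cn :: drop n.+1 c)) (drop e (drop n o))).
  move=> cE <-; rewrite necP_term_weave ?sP ?sM ?sR //; apply: eq_bigr => z _.
  have z1 : size (take n o) = n by rewrite size_takel.
  have z2 : size (take e (drop n o)) = e by rewrite size_takel ?size_drop //; lia.
  have z3 : (size (take n o) + size (drop e (drop n o))).+1 = (size c - e)%N.
    by rewrite z1 !size_drop so; lia.
  rewrite cE /= -{}z3 {}z1 {}z2 !drop_drop addnS !(addnC e n).
  by [].
rewrite cutsE; apply: eq_bigr => i _; cbv beta zeta; rewrite cutsE.
have le_i : (i <= size cn)%N by rewrite -ltnS.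
(* For e = 0 both cuts lie in the same group, and the second cut of the remaining
   inputs is counted from the first one. *)
case: e => [|e] in ne so2 sR sM ce G GT *.
  apply: etrans (@sum_shift _ (size ce) i (G i) _) _; first by rewrite /ce addn0.
  rewrite /ce addn0 -/cn -size_drop; apply: eq_bigr => j _.
  apply: GT; last by rewrite /ce addn0 drop_drop addnC.
  by rewrite (drop_nth [::] sn) /= take0 /cut /= take_drop addnC.
rewrite [nth _ (_ :: _) _]/= nth_drop addSnnS -/ce; apply: eq_bigr => j _; apply: GT => //.
have se : (e < size (drop n.+1 c))%N by rewrite size_drop; lia.
by rewrite (drop_nth [::] sn) /= (take_nth [::] se) cut_rcons nth_drop addSnnS.
Qed.

Lemma necR_term_weave x z' pre a1 oP b1 F a2 oM b2 post oR :
  size pre = size oP -> size F = size oM -> size post = size oR ->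
  necR_term x (weave (rcons pre a1) oP) b1 z' (weave (rcons F a2) oM) (weave (b2 :: post) oR) =
  \sum_z (-1) ^ (((size oP + size oR).+2%:Z - 1) * (d - 1) * (2 + 1)
            + ((size oM).+1%:Z - 1) * (d - 1) * (size oP).+1%:Z
            + (sbar b1 + sbar (flatten F) + sbar a2) * (sbar b2 + sbar (flatten post))
            + obar oR * (sbar b1 + sbar (flatten F) + sbar a2)
            + (bdeg z - 1 + sbar b1) * (sbar (flatten F) + sbar a2)
            + opbar d 2 (size oM).+1 * obar (x :: oP))
    * m (map (@vecs K A) (pre ++ a1 :: b2 :: post)) ((x :: oP) ++ z :: oR)
    * m (map (@vecs K A) (rcons F (a2 ++ belt z :: b1))) (z' :: oM).
Proof.
move=> sP sM sR.
have s1 : size (rcons pre a1) = (size oP).+1 by rewrite size_rcons sP.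
have s2 : size (rcons F a2) = (size oM).+1 by rewrite size_rcons sM.
have s3 : size (b2 :: post) = (size oR).+1 by rewrite /= sR.
have s13 z : size (pre ++ a1 :: b2 :: post) = (size (oP ++ z :: oR)).+1.
  by rewrite !size_cat /= sP sR addnS.
have s22 z : size (rcons F (a2 ++ belt z :: b1)) = (size oM).+1.
  by rewrite size_rcons sM.
apply: eq_bigr => z _; rewrite /necR_sign !in_bar_bars !out_bar_bars weave_cat_inr //.
have -> : weave (rcons F a2) oM ++ inl (belt z) :: map inl b1 =
    weave (rcons F (a2 ++ belt z :: b1)) oM.
  by have := weave_cat_inl a2 (belt z) b1 [::] [::] sM; rewrite /= !cats0 cats1.
rewrite (duals_weave s1) (duals_weave s2) (duals_weave s3) (groups_weave s2).
rewrite (groups_weave s3) (groups_weave (s13 z)) (groups_weave (s22 z)).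
rewrite -[rcons F a2]cats1 !flatten_cat /= !sbar_cat sbar_nil addr0 addrA.
by rewrite /obar big_cons.
Qed.

Lemma necR_cuts c o x n e : size c = (size o).+1 -> (n + e.+1 < size c)%N ->
  necR d 2 m m e.+1 ((size c).+1 - e.+1) n.+1 c (x :: o) =
  cuts (nth [::] c n) (fun a1 b1 =>
    cuts (nth [::] (drop n.+1 c) e) (fun a2 b2 =>
      necR_term x (weave (rcons (take n c) a1) (take n o)) b1 (nth x o n)
        (weave (rcons (take e (drop n.+1 c)) a2) (take e (drop n.+1 o)))
        (weave (b2 :: drop e.+1 (drop n.+1 c)) (drop e.+1 (drop n o))))).
Proof.
move=> so ne.
have so1 : (n < size o)%N by lia.
rewrite /necR cutsE; apply: eq_bigr => i _; cbv beta; rewrite cutsE.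
rewrite (_ : (n.+1 + e.+1).-1 = (n.+1 + e)%N); last by lia.
rewrite nth_drop; apply: eq_bigr => j _.
rewrite necR_term_weave ?size_takel ?size_drop //; try lia.
apply: eq_bigr => z _.
rewrite (_ : (size c).+1 - e.+1 = (n + (size o - n - e.+1)).+2)%N; last by lia.
rewrite !drop_drop.
have <- : take e.+1 (drop n o) = nth x o n :: take e (drop n.+1 o).
  by rewrite (drop_nth x so1).
by rewrite !(addnC e.+1).
Qed.

(** Both sides are sums over pairs of cuts, and they agree pair by pair. *)
Lemma necklace_relation w x : hom w ->
  pr (gerstenhaber 1 mu mu (elts w)) (dualv x) =
  (-1) ^ relation_sign d (bars w) (bdeg x - 1)
  * necklace d 2 2 m m (groups w) (x :: duals w).
Proof.
move=> hw; set s := (-1) ^ _; set c := groups w; set o := duals w.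
have so : size c = (size o).+1 by rewrite size_groups.
have lp : linear (pr^~ (dualv x) : B -> K^o) := standard_pairing_linearl _.
pose T p q r := pr (gerst_term mu (elts p) (elts q) (elts r)) (dualv x).
have -> : pr (gerstenhaber 1 mu mu (elts w)) (dualv x) =
    cuts w (fun p q => cuts q (T p)).
  rewrite gerstenhaber_cuts (cuts_sum _ (linear_zero lp) (linear_add lp)) cuts_map.
  apply: eq_cuts => p q _; rewrite (cuts_sum _ (linear_zero lp) (linear_add lp)) cuts_map.
  by apply: eq_cuts.
rewrite /necklace (sum_components (size c)
  (fun k l n => necP d 2 2 m m k l n c (x :: o))
  (fun k l n => necR d 2 m m k l n c (x :: o))).
rewrite -{1}(weave_groups w) -/c -/o cuts_weave // big_mkord mulr_sumr.
apply: eq_bigr => n _; move: (ltn_ord n); move: (nat_of_ord n) => {}n sn.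
have so1 : (n <= size o)%N by rewrite -ltnS -so.
have so2 a : size (a :: drop n.+1 c) = (size (drop n o)).+1.
  by rewrite /= !size_drop so subSS.
have sz : (size c - n)%N = (size (drop n o)).+1 by rewrite size_drop so subSn.
pose c2 b := b :: drop n.+1 c.
pose p a1 := weave (rcons (take n c) a1) (take n o).
pose q b1 e a2 := weave (rcons (take e (c2 b1)) a2) (take e (drop n o)).
pose r b1 e b2 := weave (b2 :: drop e.+1 (c2 b1)) (drop e (drop n o)).
pose G a1 b1 e := cuts (nth [::] (c2 b1) e) (fun a2 b2 => T (p a1) (q b1 e a2) (r b1 e b2)).
transitivity (\sum_(0 <= e < size c - n) cuts (nth [::] c n) (fun a1 b1 => G a1 b1 e)).
  rewrite cutsE big_mkord.
  under [RHS]eq_bigr do rewrite cutsE.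
  rewrite exchange_big; apply: eq_bigr => i _; rewrite cuts_weave //.
  by rewrite so2 sz.
rewrite mulr_sumr; apply: eq_big_nat => e /andP[_ se].
have w_cat a1 b1 a2 b2 : nth [::] c n = a1 ++ b1 -> nth [::] (c2 b1) e = a2 ++ b2 ->
    w = p a1 ++ q b1 e a2 ++ r b1 e b2.
  move=> E1 E2; rewrite /q /r weave_cat; last first.
    by rewrite !size_takel // ?so2 size_drop; lia.
  rewrite -E2 cat_take_drop -drop_nth; last by rewrite /c2 so2 -sz.
  rewrite cat_take_drop /p weave_cat; last by rewrite !size_takel // ltnW.
  rewrite -E1 cat_take_drop -drop_nth // cat_take_drop.
  by rewrite weave_groups.
have mulD : {morph *%R s : u v / u + v} by exact: mulrDr.
case: e => [|e] in se w_cat *.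
  rewrite addr0 necP_cuts ?addn0 // (cuts_sum _ (mulr0 s) mulD).
  apply: eq_cuts => a1 b1 E1; rewrite (cuts_sum _ (mulr0 s) mulD).
  apply: eq_cuts => a2 b2 E2; rewrite /T.
  have := w_cat _ _ _ _ E1 E2; rewrite /s => wE.
  move: hw; rewrite wE all_cat (all_cat _ (q _ _ _)) => /and3P[hp hq hr].
  have qE : q b1 0 a2 = map inl a2 by rewrite /q !take0 /= cats0.
  by rewrite qE in hq *; rewrite gerst_term_sub // -qE.
rewrite mulrDr necP_cuts ?necR_cuts //; try lia.
rewrite !(cuts_sum _ (mulr0 s) mulD) -cutsD; apply: eq_cuts => a1 b1 E1.
rewrite !(cuts_sum _ (mulr0 s) mulD) -cutsD; apply: eq_cuts => a2 b2 E2.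
rewrite -mulrDr /T.
have := w_cat _ _ _ _ E1 E2; rewrite /s => wE.
move: hw; rewrite wE all_cat (all_cat _ (q _ _ _)) => /and3P[hp hq hr].
have so3 : (n < size o)%N by rewrite size_drop in sz; lia.
have qE : q b1 e.+1 a2 = map inl b1 ++ inr (nth x o n) ::
    weave (rcons (take e (drop n.+1 c)) a2) (take e (drop n.+1 o)).
  by rewrite /q (drop_nth x so3).
by rewrite qE in hq *; rewrite gerst_term_dual // -qE.
Qed.
End NecklaceRelation.

(** * Cyclic invariance of the Gerstenhaber square *)

Section GerstenhaberCyclic.
Context (K : fieldType) (B : gradedSpace K) (e : int).
Context (pr : B -> B -> K) (mu : seq B -> B).
Hypothesis prP : is_pairing e pr.
Hypothesis mu_cyc : cyclic_inv pr mu.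
Hypothesis mu_nil : mu [::] = 0.
Hypothesis mu_degree : forall s : seq (gelt B), all (@homog K B) s ->
  mu (vecs s) \in gs_part B (sbar s + 2).
Implicit Types (s p q r w : seq (gelt B)) (x z : gelt B).
Local Notation hom := (all (@homog K B)).

Let pairing0r u : pr u 0 = 0.
Proof. exact: (@linear_zero _ _ K^o (pr u) (pairing_linearr prP u)). Qed.

(** The value <mu(r p), mu(q)> of a splitting of a cyclic word into two arcs, with
    the sign of bringing the inner operation to the end.  In this form the two
    operations play symmetric roles. *)
Definition split_term p q r : K :=
  (-1) ^ (sbar p + (sbar p + sbar q + 1) * sbar r)
  * pr (mu (vecs (r ++ p))) (mu (vecs q)).

Lemma split_term_nil p r : split_term p [::] r = 0.
Proof. by rewrite /split_term mu_nil pairing0r mulr0. Qed.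

Definition gcyc w : K :=
  if w is x :: t then pr (gerstenhaber 1 mu mu (belast x t)) (last x t).2 else 0.

Lemma gcyc_rcons s z : gcyc (rcons s z) = pr (gerstenhaber 1 mu mu s) z.2.
Proof. by case: s => //= x t; rewrite belast_rcons last_rcons. Qed.

Lemma gcyc_split s z : hom s -> homog z ->
  gcyc (rcons s z) = cuts s (fun p r' => cuts r' (fun q r => split_term p q (rcons r z))).
Proof.
move=> hs hz; have lp : linear (pr^~ z.2 : B -> K^o) := pairing_linearl prP _.
rewrite gcyc_rcons gerstenhaber_cuts (cuts_sum _ (linear_zero lp) (linear_add lp)).
apply: eq_cuts => p r' sE; rewrite (cuts_sum _ (linear_zero lp) (linear_add lp)).
apply: eq_cuts => q r rE; move: hs; rewrite sE rE !all_cat => /and3P[hp hq hr].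
rewrite /gerst_term (linear_scale lp) /split_term -[_ *: _]/(_ * _).
pose y : gelt B := (sbar q + 2, mu (vecs q)).
have hy : homog y by exact: mu_degree.
rewrite -!cyc_rcons.
have -> : rcons (vecs p ++ mu (vecs q) :: vecs r) z.2 = vecs (rcons p y ++ rcons r z).
  by rewrite cat_rcons vecs_cat /= vecs_rcons rcons_cat.
rewrite (cyc_rot mu_cyc) ?all_rcons ?hy ?hz //.
rewrite -rcons_cat vecs_rcons mulrA sign_mul; congr (_ * _); apply: sign_congr.
by apply: parity_eq; rewrite !sbar_rcons /= !oddzE; truth_table.
Qed.

(** A rotation permutes the splittings into two arcs; when the letter that moves
    was part of the inner arc, it makes that arc the outer one, and skew symmetry
    of the pairing accounts for the sign. *)
Lemma gcyc_rot1 x w : homog x -> hom w ->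
  gcyc (x :: w) = (-1) ^ ((x.1 - 1) * sbar w) * gcyc (rcons w x).
Proof.
move=> hx; case/lastP: w => [_|w z].
  by rewrite sbar_nil mulr0 expr0z mul1r.
rewrite all_rcons => /andP[hz hw].
have := @gcyc_split (x :: w) z; rewrite rcons_cons => -> //; last by rewrite /= hx.
rewrite gcyc_split ?all_rcons ?hz //= split_term_nil add0r cuts_rcons /=.
rewrite split_term_nil !addr0.
have mulD (s : K) : {morph *%R s : u v / u + v} by exact: mulrDr.
rewrite (cuts_sum _ (mulr0 _) (mulD _)) addrC -cutsD; apply: eq_cuts => p r' wE.
rewrite cuts_rcons mulrDr (cuts_sum _ (mulr0 _) (mulD _)).
move: hw; rewrite wE all_cat => /andP[hp hr'].
congr (_ + _).
  apply: eq_cuts => q r rE; rewrite rE /split_term mulrA sign_mul [in RHS]cat_rcons.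
  congr (_ * _); apply: sign_congr; apply: parity_eq.
  by rewrite !sbar_rcons !sbar_cons !sbar_cat !oddzE; truth_table.
(* The arcs are x p and r' z on both sides, and the inner one is the first on the
   left and the second on the right. *)
rewrite /split_term cats0.
have h1 : homog (sbar (x :: p) + 2, mu (vecs (x :: p))).
  by apply: mu_degree; rewrite /= hx.
have h2 : homog (sbar (rcons r' z) + 2, mu (vecs (rcons r' z))).
  by apply: mu_degree; rewrite all_rcons hz.
have /= -> := pairing_skew prP h2 h1.
rewrite mulrN -mulN1r -(expr1z (-1 : K)) !mulrA !sign_mul; congr (_ * _).
apply: sign_congr; apply: parity_eq.
by rewrite sbar_nil !sbar_rcons !sbar_cons !sbar_cat sbar_nil !oddzE; truth_table.
Qed.
End GerstenhaberCyclic.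

(** * Multilinear extension from basis letters *)

Section Extension.
Context (K : fieldType).

(** To see that F vanishes on all words with letters in P, it suffices to reduce
    one letter at a time to the letters [b j]. *)
Lemma slotwise_zero (J T : Type) (W : lmodType K) (b : J -> T) (P : T -> bool) (F : seq T -> W) :
  (forall u t v, P t -> (forall j, F (u ++ b j :: v) = 0) -> F (u ++ t :: v) = 0) ->
  (forall s, F (map b s) = 0) -> forall s, all P s -> F s = 0.
Proof.
move=> slot F0 s hs; rewrite -[s]cat0s -[[::]]/(map b [::]).
elim: s [::] hs => [|t s IH] u /=; first by rewrite cats0.
case/andP=> Pt hs; apply: slot => // j.
by have := IH (rcons u j) hs; rewrite map_rcons cat_rcons.
Qed.

Context (V : lmodType K) (J : finType) (co : J -> V -> K).
Hypothesis co_lin : forall j, scalar (co j).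

Fixpoint multi_ext (g : seq J -> K) (s : seq V) : K :=
  if s is v :: s' then \sum_j co j v * multi_ext (fun t => g (j :: t)) s' else g [::].

Lemma multi_ext_linear g : multilinear (multi_ext g : seq V -> K^o).
Proof.
move=> s1 s2 c u v; elim: s1 g => [|w s1 IH] g /=.
  rewrite scaler_sumr -big_split; apply: eq_bigr => j _ /=.
  by rewrite co_lin mulrDl -mulrA.
rewrite scaler_sumr -big_split; apply: eq_bigr => j _ /=.
rewrite IH mulrDr; congr (_ + _); exact: mulrCA.
Qed.

Lemma multi_ext_basis (b : J -> V) g s : (forall i j, co i (b j) = (i == j)%:R) ->
  multi_ext g (map b s) = g s.
Proof.
move=> cob; elim: s g => [|i s IH] g //=.
rewrite (bigD1 i) //= cob eqxx mul1r IH big1 ?addr0 // => j ji.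
by rewrite cob (negbTE ji) mul0r.
Qed.

(** If the coordinates of the entries of s outside Q vanish, only the values of g
    on words in Q matter. *)
Lemma multi_ext_zero (Q : pred J) (P : V -> Prop) g s :
  (forall v j, P v -> ~~ Q j -> co j v = 0) -> (forall v, List.In v s -> P v) ->
  (forall t, all Q t -> g t = 0) -> multi_ext g s = 0.
Proof.
move=> coP; elim: s g => [|v s IH] g /= sP g0; first exact: g0.
apply: big1 => j _; have [Qj|Qj] := boolP (Q j); last first.
  by rewrite coP ?mul0r //; apply: sP; left.
rewrite IH ?mulr0 // => [w ws|t Qt]; first by apply: sP; right.
by apply: g0; rewrite /= Qj.
Qed.
End Extension.

Section BasisLetters.
Context (K : fieldType) (A : gradedSpace K) (d : int).
Local Notation B := (dual_double A d).
Local Notation pr := (@standard_pairing K A d).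
Local Notation letter := (letter A).
Local Notation elts := (@word_elts K A d).
Local Notation dualv := (@dual_basis_vec K A d).

Definition basis_index : finType := (bidx A + bidx A)%type.

Definition basis_letter (j : basis_index) : letter :=
  match j with inl x => inl (belt x) | inr x => inr x end.

Lemma basis_letter_homog s : all (@homog_letter K A) (map basis_letter s).
Proof. by elim: s => [|[x|x] s IH] //=; rewrite /homog bvec_homog. Qed.

Definition bcoord (j : basis_index) (v : B) : K :=
  match j with inl x => dvec x v.1 | inr x => v.2 (bvec x) end.

Lemma bcoord_linear j : scalar (bcoord j).
Proof.
case: j => x c u v /=; first by rewrite linearP.
by rewrite add_lfunE scale_lfunE.
Qed.

Definition basis_vec (j : basis_index) : B := (letter_elt d (basis_letter j)).2.

Lemma bcoord_basis i j : bcoord i (basis_vec j) = (i == j)%:R.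
Proof.
case: i j => x [] y.
- exact: dvec_bvec.
- exact: (linear0 (dvec x)).
- by rewrite [LHS]zero_lfunE.
by apply: etrans (dvec_bvec y x) _; rewrite eq_sym.
Qed.

Lemma bcoord_expand (v : B) : v = \sum_j bcoord j v *: basis_vec j.
Proof.
rewrite big_sumType /= {1}[v]dual_double_expand; congr (_ + _).
Qed.

Lemma bcoord_homog (n : int) (v : B) j : v \in gs_part B n -> bcoord j v != 0 ->
  (letter_elt d (basis_letter j)).1 = n.
Proof.
rewrite mem_gsum => /andP[v1 v2] /eqP h; apply/eqP; case: j h => x h /=.
  by apply: contra_notT h => xn; exact: dvec_homog v1 xn.
apply: contra_notT h => xn; apply: (dual_homog v2); apply: contra xn => /eqP ->.
by apply/eqP; ring.
Qed.

(** Signs depend on degrees, so linearity is available only with the degree of the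
    slot held fixed; that is enough, since a homogeneous vector is a combination
    of basis vectors of its own degree. *)
Lemma homog_slotwise_zero (W : lmodType K) (F : seq (gelt B) -> W) :
  (forall u n v, linear (fun x => F (u ++ (n, x) :: v))) ->
  (forall s, F (elts (map basis_letter s)) = 0) ->
  forall s, all (@homog K B) s -> F s = 0.
Proof.
move=> lF F0; apply: (@slotwise_zero _ _ _ _ (fun j => letter_elt d (basis_letter j))).
  move=> u [n x] v; rewrite /homog /= => xn Fj.
  have lf := lF u n v; rewrite [x]bcoord_expand (linear_big_sum lf) big1 // => j _.
  rewrite (linear_scale lf); have [->|h] := eqVneq (bcoord j x) 0; first by rewrite scale0r.
  rewrite -(bcoord_homog xn h) /basis_vec; have := Fj j.
  by case: (letter_elt _ _) => k y /= ->; rewrite scaler0.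
by move=> s; rewrite -[RHS](F0 s) /word_elts -map_comp.
Qed.

Lemma letter_slotwise_zero (W : lmodType K) (F : seq letter -> W) :
  (forall u n v, linear (fun x : A => F (u ++ inl (n, x) :: v))) ->
  (forall s, F (map basis_letter s) = 0) ->
  forall w, all (@homog_letter K A) w -> F w = 0.
Proof.
move=> lF F0; apply: (@slotwise_zero _ _ _ _ basis_letter) => //.
move=> u [[n x]|x] v hl Fj; last exact: (Fj (inr x)).
have lf := lF u n v; rewrite [x]basis_expand (linear_big_sum lf) big1 // => j _.
rewrite (linear_scale lf); have [jn|jn] := eqVneq (bdeg j) n; last first.
  by rewrite (dvec_homog hl jn) scale0r.
by have := Fj (inl j); rewrite /= /belt jn => ->; rewrite scaler0.
Qed.

Lemma vector_slotwise_zero (W : lmodType K) (F : seq B -> W) :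
  (forall u v, linear (fun x => F (u ++ x :: v))) ->
  (forall s, F (vecs (elts (map basis_letter s))) = 0) -> forall s, F s = 0.
Proof.
move=> lF F0 s; apply: (@slotwise_zero _ _ _ _ basis_vec xpredT); last exact: all_predT.
  move=> u x v _ Fj; have lf := lF u v.
  rewrite [x]bcoord_expand (linear_big_sum lf) big1 // => j _.
  by rewrite (linear_scale lf) Fj scaler0.
by move=> t; rewrite -[RHS](F0 t) /vecs /word_elts -!map_comp.
Qed.

Section Slots.
Context (mu : seq B -> B) (m : cochain A).
Hypothesis mu_lin : multilinear mu.
Hypothesis m_lin : forall c1 c2 o,
    multilinear (fun s : seq A => m (c1 ++ s :: c2) o : K^o).

Lemma cochain_slot_linear (u v : seq (A + bidx A)) o :
  linear (fun x : A => m (groups (u ++ inl x :: v)) o : K^o).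
Proof.
move=> c x y; have [c1 [s1 [s2 [c2 E]]]] := groups_split u v.
by rewrite !E; exact: m_lin.
Qed.

Lemma cochain_letter_linear u n v o :
  linear (fun x : A => m (map (@vecs K A) (groups (u ++ inl (n, x) :: v : seq letter))) o : K^o).
Proof.
pose f := map_letter (fun g : gelt A => g.2) (@id (bidx A)).
have E x : map (@vecs K A) (groups (u ++ inl (n, x) :: v : seq letter)) =
    groups (map f u ++ inl x :: map f v).
  by rewrite -[inl x]/(f (inl (n, x))) -map_cons -map_cat groups_map.
by move=> c x y; rewrite !E; exact: cochain_slot_linear.
Qed.

Lemma duals_inl_eq (u v : seq letter) (a a' : gelt A) :
  duals (u ++ inl a :: v) = duals (u ++ inl a' :: v).
Proof. by rewrite !duals_cat. Qed.

Lemma mu_letter_linear u n v z :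
  linear (fun x : A => pr (mu (vecs (elts (u ++ inl (n, x) :: v)))) z : K^o).
Proof.
move=> c x y; rewrite !elts_cat !vecs_cat /= (inA_linear _ c) mu_lin.
exact: (standard_pairing_linearl z c (mu _) (mu _)).
Qed.

(** Both sides are linear in every input, with a sign that depends on degrees
    only. *)
Lemma word_corr_basis : (forall s x, pr (mu (vecs (elts (map basis_letter s)))) (dualv x)
    = (-1) ^ corr_sign d (bars (map basis_letter s)) (bdeg x - 1)
      * m (map (@vecs K A) (groups (map basis_letter s))) (x :: duals (map basis_letter s))) ->
  word_corr m mu.
Proof.
move=> h w x hw; apply/eqP; rewrite -subr_eq0; apply/eqP; move: w hw.
apply: (@letter_slotwise_zero K^o) => [u n v c y z|s]; last by rewrite h subrr.
rewrite !bars_cat !bars_inl /= !(duals_inl_eq u v (n, _) (n, 0)).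
rewrite (mu_letter_linear u n v (dualv x) c) (cochain_letter_linear u n v _ c).
exact: linear_sub_sign.
Qed.
End Slots.
End BasisLetters.

(** * The A-infinity relation *)

Section SplitDual.
Context (X Y : Type).

Fixpoint split_dual (w : seq (X + Y)) : option (seq X * Y * seq (X + Y)) :=
  match w with
  | [::] => None
  | inl a :: w' => if split_dual w' is Some (s, y, v) then Some (a :: s, y, v) else None
  | inr y :: w' => Some ([::], y, w')
  end.

Lemma split_dualP w : match split_dual w with
  | None => exists a, w = map inl a
  | Some (a, y, v) => w = map inl a ++ inr y :: v end.
Proof.
elim: w => [|[x|y] w IH] //=; first by exists [::].
case: split_dual IH => [[[a y] v] ->|[a ->]] //=.
by exists (x :: a).
Qed.

Lemma split_dual_cat a y v : split_dual (map inl a ++ inr y :: v) = Some (a, y, v).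
Proof. by elim: a => //= x a ->. Qed.

Lemma split_dual_inl a : split_dual (map inl a) = None.
Proof. by elim: a => //= x a ->. Qed.
End SplitDual.

Section Ainf.
Context (K : fieldType) (A : gradedSpace K) (d : int).
Local Notation B := (dual_double A d).
Local Notation pr := (@standard_pairing K A d).
Local Notation letter := (letter A).
Local Notation elts := (@word_elts K A d).
Local Notation dualv := (@dual_basis_vec K A d).
Local Notation hom := (all (@homog_letter K A)).
Context (m : cochain A) (mu : seq B -> B).
Hypothesis m_degree : degree_law d m.
Hypothesis mu_cyc : cyclic_inv pr mu.
Hypothesis mu_lin : multilinear mu.
Hypothesis mu_sub : is_subalgebra mu.
Hypothesis corr : word_corr m mu.
Hypothesis mu_nil : mu [::] = 0.
Hypothesis mu_degree : forall s : seq (gelt B), all (@homog K B) s ->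
  mu (vecs s) \in gs_part B (sbar s + 2).
Hypothesis m_necklace : forall (c : seq (seq (gelt A))) o,
    all (all (@homog K A)) c -> size o = size c -> necklace d 2 2 m m c o = 0.

Lemma gerstenhaber_sub (a : seq (gelt A)) :
  (gerstenhaber 1 mu mu (elts (map inl a))).2 = 0.
Proof.
have snd_lin : linear (snd : B -> _) by [].
rewrite gerstenhaber_cuts (cuts_sum _ (linear_zero snd_lin) (linear_add snd_lin)) !cuts_map.
rewrite cutsE big1 // => i _; rewrite (cuts_sum _ (linear_zero snd_lin) (linear_add snd_lin)).
rewrite !cuts_map cutsE big1 // => j _; rewrite /gerst_term (linear_scale snd_lin).
rewrite !vecs_elts_inl.
set v := mu [seq _ | _ <- _]; have -> : v = inA _ v.1 by rewrite {1}[v]surjective_pairing mu_sub.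
by rewrite -map_cons -map_cat mu_sub scaler0.
Qed.

(** A word with a dual letter is rotated until that letter comes last, where the
    necklace equation applies; a word in A is zero because A is a subalgebra. *)
Lemma gcyc_letters w : hom w -> gcyc pr mu (elts w) = 0.
Proof.
move=> hw; have := split_dualP w; case: split_dual => [[[a y] v] E|[a ->]].
  rewrite E -cat_rcons elts_cat.
  have hE : hom (rcons (map inl a) (inr y)) && hom v.
    by rewrite -all_cat cat_rcons -E.
  case/andP: hE => h1 h2.
  rewrite (rotate_cat (T := gcyc pr mu)) ?elts_homog //; last first.
    by move=> z s; apply: (gcyc_rot1 (standard_pairingP A d)).
  rewrite -elts_cat -rcons_cat elts_rcons gcyc_rcons.
  rewrite (necklace_relation m_degree mu_cyc mu_lin mu_sub corr).
    rewrite m_necklace ?mulr0 //; last by rewrite size_groups.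
    by apply: all_homog_groups; rewrite all_cat h2; move: h1; rewrite all_rcons.
  by rewrite all_cat h2; move: h1; rewrite all_rcons.
case/lastP: a hw => [//|a g] hw; rewrite map_rcons elts_rcons gcyc_rcons.
by rewrite standard_pairing_inA gerstenhaber_sub zero_lfunE.
Qed.


Lemma linear_sum_of (V W : lmodType K) (f g h : V -> W) :
  (forall x, h x = f x + g x) -> linear f -> linear g -> linear h.
Proof.
by move=> hE lf lg c x y; rewrite !hE lf lg scalerDr; exact: addrACA.
Qed.

(** The slot lies to the right of the inner operation, inside it, or to its
    left. *)
Lemma gerstenhaber_linear u n v :
  linear (fun x => gerstenhaber 1 mu mu (u ++ (n, x) :: v)).
Proof.
apply: linear_sum_of => [x||]; first by rewrite gerstenhaber_cuts cuts_cat.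
  apply: cuts_linear => p r.
  apply: linear_sum_of => [x||]; first by rewrite cuts_cat.
    apply: cuts_linear => q r' c x y; rewrite /gerst_term !vecs_cat /=.
    have := mu_lin (vecs p ++ mu (vecs q) :: vecs r') (vecs v) c x y.
    rewrite -!catA !cat_cons => ->; rewrite scalerDr !scalerA; congr (_ *: _ + _).
    exact: mulrC.
  apply: cuts_linear => q r' c x y; rewrite /gerst_term !vecs_cat /= mu_lin mu_lin.
  by rewrite scalerDr !scalerA mulrC.
apply: cuts_linear => p r; apply: cuts_linear => q r' c x y.
rewrite /gerst_term !vecs_cat /= !sbar_cat !sbar_cons /=.
rewrite -!catA !cat_cons mu_lin.
by rewrite scalerDr !scalerA mulrC.
Qed.

Lemma gcyc_zero s : all (@homog K B) s -> gcyc pr mu s = 0.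
Proof.
move: s; apply: (@homog_slotwise_zero K A d K^o) => [u n v|s]; last first.
  by apply: gcyc_letters; exact: basis_letter_homog.
case/lastP: v => [|v z] c x y.
  by rewrite !cats1 !gcyc_rcons; exact: (standard_pairing_linearr _ c).
rewrite -!rcons_cons -!rcons_cat !gcyc_rcons (gerstenhaber_linear u n v).
exact: (standard_pairing_linearl z.2 c (gerstenhaber _ _ _ _)).
Qed.

Lemma Ainf_of_necklace : is_Ainf mu.
Proof.
split => // s hs; apply: (pairing_nondegenerate (standard_pairingP A d)) => y.
have lp : linear (pr (gerstenhaber 1 mu mu s) : B -> K^o) := standard_pairing_linearr _.
rewrite [y](bcoord_expand) (linear_big_sum lp) big1 // => j _.
rewrite (linear_scale lp) -gcyc_rcons gcyc_zero ?scaler0 //.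
rewrite all_rcons hs andbT; apply: letter_homog.
exact: (allP (basis_letter_homog [:: j])) (mem_head _ _).
Qed.
End Ainf.

(** * From cochains to cyclic structures *)

Section Build.
Context (K : fieldType) (A : gradedSpace K) (d : int).
Local Notation B := (dual_double A d).
Local Notation pr := (@standard_pairing K A d).
Local Notation letter := (letter A).
Local Notation elts := (@word_elts K A d).
Local Notation dualv := (@dual_basis_vec K A d).
Local Notation hom := (all (@homog_letter K A)).
Context (m : cochain A).
Hypothesis mP : is_preCY d m.
Local Notation mw w o := (m (map (@vecs K A) (groups w)) o).
Implicit Types (w v : seq letter) (x y z : bidx A).

Let m_degree : degree_law d m := cochain_degree (preCY_cochain mP).

(** The tensor of the structure to be built, on a word of letters: the first dual
    letter is rotated to the end, and [corr_sign] and m give the value there. *)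
Definition letter_tensor w : K :=
  if split_dual w is Some (a, x, v) then
    (-1) ^ ((sbar a + (d - 2 - bdeg x)) * sbar (elts v)
            + corr_sign d (bars (v ++ map inl a)) (bdeg x - 1))
    * mw (v ++ map inl a) (x :: duals v)
  else 0.

(** Only one case is not formal: if the first letter is an output and another
    output follows, the two sides rotate to different outputs, and the cyclic
    invariance of m compares them. *)
Lemma letter_tensor_rot l w : homog_letter l -> hom w ->
  letter_tensor (l :: w) =
  (-1) ^ (((letter_elt d l).1 - 1) * sbar (elts w)) * letter_tensor (rcons w l).
Proof.
move=> hl hw; have := split_dualP w; rewrite /letter_tensor.
case E: (split_dual w) => [[[a x] v]|]; case: l hl => [g|x'] hl wE /=.
- rewrite E wE rcons_cat rcons_cons split_dual_cat /= cat_rcons.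
  have -> : duals (rcons v (inl g)) = duals v by rewrite -cats1 duals_cat cats0.
  rewrite mulrA sign_mul; congr (_ * _); apply: sign_congr; apply: parity_eq.
  rewrite elts_rcons elts_cat elts_inr sbar_rcons sbar_cat !sbar_cons sbar_elts_inl /=.
  by move: (corr_sign _ _ _) => C; rewrite !oddzE; truth_table.
- rewrite wE rcons_cat rcons_cons split_dual_cat /= cat_rcons sbar_nil.
  have -> : duals (rcons v (inr x')) = rcons (duals v) x'.
    by rewrite -!cats1 duals_cat.
  move: hw; rewrite wE all_cat /= => /andP[ha hv].
  have gE : groups (map inl a ++ inr x :: v : seq letter) = a :: groups v.
    by rewrite groups_cat_inl /= cats0.
  have gE' : groups (v ++ inr x' :: map inl a : seq letter) = rcons (groups v) a.
    by rewrite groups_cat_inr groups_inl cats1.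
  have ha' : all (@homog K A) a by rewrite all_map in ha.
  have := cochain_cyclic (preCY_cochain mP) x' (x :: duals v) ha' (all_homog_groups hv).
  rewrite -map_rcons -gE' => ->; rewrite -[vecs a :: _]/(map (@vecs K A) (a :: groups v)) -gE.
  have dE : x :: duals v = duals (map inl a ++ inr x :: v : seq letter).
    by rewrite duals_cat duals_inl.
  have hw : hom (map inl a ++ inr x :: v) by rewrite all_cat ha.
  rewrite cats0 dE.
  have [->|m0] := eqVneq (mw (map inl a ++ inr x :: v : seq letter)
    (x' :: duals (map inl a ++ inr x :: v : seq letter))) 0; first by rewrite !mulr0.
  have := word_parity m_degree hw m0.
  rewrite !mulrA !sign_mul => P; congr (_ * _); apply: sign_congr; move: P; apply: parity_eq_if.
  rewrite -!dE -in_bar_bars size_groups -(cat1s x) /obar !big_cat !big_seq1 -/(obar _) -out_bar_bars.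
  rewrite /corr_sign !elts_rcons !sbar_rcons !elts_cat !sbar_cat !elts_inr !sbar_cons.
  rewrite !sbar_elts_inl !sbar_elts !barsE !wordE !word_sign_cat /= !wordE !word_sign_inl.
  rewrite out_bar_bars_inl out_num_bars_inl in_bar_bars_inl intS -out_num_bars.
  by rewrite !oddzE; truth_table.
- by rewrite E; case: wE => a ->; rewrite -map_rcons split_dual_inl mulr0.
case: wE => a wE; rewrite wE -cats1 split_dual_cat /= cats0 mulrA sign_mul.
rewrite !sbar_nil sbar_elts_inl duals_inl; congr (_ ^ _ * _).
ring.
Qed.

Lemma letter_tensor_last w x : hom w ->
  letter_tensor (rcons w (inr x)) =
  (-1) ^ corr_sign d (bars w) (bdeg x - 1) * mw w (x :: duals w).
Proof.
move=> hw; have := @letter_tensor_rot (inr x) w isT hw.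
rewrite {1}/letter_tensor /= cats0 sbar_nil.
set D := (d - 1 - bdeg x - 1) * _; set C := corr_sign _ _ _.
have -> : (0 + (d - 2 - bdeg x)) * sbar (elts w) + C = D + C.
  by congr (_ + _); rewrite /D; ring.
rewrite -sign_mul -mulrA => /mulfI -> //.
by rewrite exprN1z signr_eq0.
Qed.

Lemma letter_tensor_degree w : hom w -> letter_tensor w != 0 ->
  sbar (elts w) = d - 4.
Proof.
move=> hw; rewrite /letter_tensor; have := split_dualP w.
case: split_dual => [[[a x] v] wE|]; last by rewrite eqxx.
rewrite mulf_eq0 negb_or => /andP[_].
have -> : duals v = duals (v ++ map inl a : seq letter).
  by rewrite duals_cat duals_inl cats0.
have hv : hom (v ++ map inl a).
  by move: hw; rewrite wE !all_cat /= => /andP[-> ->].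
move=> /(word_degree m_degree hv); rewrite wE sbar_elts !barsE !wordE.
rewrite out_bar_bars_inl out_num_bars_inl in_bar_bars_inl => E.
have -> : out_bar (bars v) = bdeg x + (out_bar (bars v) + 0) - bdeg x by ring.
rewrite E; ring.
Qed.

Definition tensorB : seq B -> K :=
  multi_ext (@bcoord K A d) (fun s => letter_tensor (map (@basis_letter K A) s)).

Lemma tensorB_linear : multilinear (tensorB : seq B -> K^o).
Proof. apply: multi_ext_linear; exact: bcoord_linear. Qed.

Lemma tensorB_basis s : tensorB (vecs (elts (map (@basis_letter K A) s)))
  = letter_tensor (map (@basis_letter K A) s).
Proof.
have -> : vecs (elts (map (@basis_letter K A) s)) = map (@basis_vec K A d) s.
  by rewrite /vecs /word_elts -!map_comp.
exact: (multi_ext_basis _ s (@bcoord_basis K A d)).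
Qed.

Lemma tensorB_rot1 (x : gelt B) (w : seq (gelt B)) : homog x -> all (@homog K B) w ->
  tensorB (vecs (x :: w)) = (-1) ^ ((x.1 - 1) * sbar w) * tensorB (vecs (rcons w x)).
Proof.
move=> hx hw; apply/eqP; rewrite -subr_eq0; apply/eqP.
pose F (s : seq (gelt B)) : K^o := if s is x :: w then
  tensorB (vecs (x :: w)) - (-1) ^ ((x.1 - 1) * sbar w) * tensorB (vecs (rcons w x)) else 0.
suff F0 s : all (@homog K B) s -> F s = 0 by apply: (F0 (x :: w)); rewrite /= hx.
move: s {x w hx hw}; apply: homog_slotwise_zero => [u n v|[//|j s]]; last first.
  rewrite map_cons elts_cons /F -elts_rcons -map_rcons -elts_cons -map_cons !tensorB_basis.
  have := basis_letter_homog (j :: s); rewrite [map _ _]/= [all _ _]/= => /andP[hj hs].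
  by rewrite letter_tensor_rot // map_rcons subrr.
have lT := tensorB_linear.
case: u => [|x u] c y z /=.
  rewrite !vecs_rcons -!cats1; have /= -> := lT [::] (vecs v) c y z.
  rewrite (lT (vecs v) [::] c y z).
exact: linear_sub_sign.
rewrite !rcons_cat !rcons_cons !sbar_cat !sbar_cons !vecs_cat /=.
have /= -> := lT (x.2 :: vecs u) (vecs v) c y z.
rewrite (lT (vecs u) (vecs (rcons v x)) c y z).
exact: linear_sub_sign.
Qed.

Lemma tensorB_degree (s : seq (gelt B)) : all (@homog K B) s ->
  tensorB (vecs s) != 0 -> sbar s = d - 4.
Proof.
move=> hs; apply: contra_neq_eq => sd; move: (hs).
pose F (s : seq (gelt B)) : K^o := if sbar s == d - 4 then 0 else tensorB (vecs s).
suff F0 t : all (@homog K B) t -> F t = 0.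
  by move=> /F0; rewrite /F (negbTE sd).
move: t; apply: homog_slotwise_zero => [u n v c y z|t]; rewrite /F.
  rewrite !sbar_cat !sbar_cons /=; case: ifP => _; first by rewrite scaler0 addr0.
  by rewrite !vecs_cat; exact: tensorB_linear.
case: eqP => // td; rewrite tensorB_basis; apply/eqP.
by apply: contra_notT td; apply: letter_tensor_degree; exact: basis_letter_homog.
Qed.

(** The coordinates of mu(s), chosen so that pairing with the basis of B gives back
    [tensorB]. *)
Definition mu_coef (s : seq B) (j : basis_index A) : K :=
  match j with
  | inl z => - ((-1) ^ ((bdeg z - 1) * (d - 2 - bdeg z)) * tensorB (rcons s (basis_vec d (inr z))))
  | inr z => tensorB (rcons s (basis_vec d (inl z)))
  end.

Definition preCY_mu (s : seq B) : B := \sum_j mu_coef s j *: basis_vec d j.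

Lemma bcoord_preCY_mu s j : bcoord j (preCY_mu s) = mu_coef s j.
Proof.
have lb : linear (bcoord j : B -> K^o) := bcoord_linear j.
rewrite (linear_big_sum lb) (bigD1 j) //= (linear_scale lb) bcoord_basis eqxx.
rewrite big1 ?addr0 => [|i ij]; first exact: mulr1.
by rewrite (linear_scale lb) bcoord_basis eq_sym (negbTE ij) scaler0.
Qed.

Lemma pairing_preCY_mu (s : seq B) (v : B) : pr (preCY_mu s) v = tensorB (rcons s v).
Proof.
have lp : linear (pr (preCY_mu s) : B -> K^o) := standard_pairing_linearr _.
have lT := tensorB_linear s [::].
have basis j : pr (preCY_mu s) (basis_vec d j) = tensorB (s ++ [:: basis_vec d j]).
  rewrite cats1; case: j => z.
    by rewrite [LHS]standard_pairing_inA -[LHS]/(bcoord (inr z) (preCY_mu s)) bcoord_preCY_mu.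
  rewrite [LHS]standard_pairing_inV -[dvec z _]/(bcoord (inl z) (preCY_mu s)) bcoord_preCY_mu /=.
  by rewrite mulrN opprK mulrA exprN1z -signr_addb addbb mul1r.
rewrite [v]bcoord_expand (linear_big_sum lp) -cats1 (linear_big_sum lT).
by apply: eq_bigr => j _; rewrite (linear_scale lp) (linear_scale lT) basis.
Qed.

Lemma preCY_mu_cyclic : cyclic_inv pr preCY_mu.
Proof.
move=> x z s hx hz hs; rewrite !pairing_preCY_mu rcons_cons -!vecs_rcons.
by apply: (tensorB_rot1 hx); rewrite all_rcons hz.
Qed.

Lemma preCY_mu_linear : multilinear preCY_mu.
Proof.
move=> s1 s2 c u v; rewrite /preCY_mu scaler_sumr -big_split; apply: eq_bigr => j _ /=.
rewrite scalerA -scalerDl; congr (_ *: _).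
have lT (t : B) := tensorB_linear s1 (rcons s2 t) c u v.
case: j => z /=; rewrite !rcons_cat !rcons_cons lT -[_ *: _]/(_ * _) //=.
rewrite mulrDr opprD mulrN; congr (- _ - _); exact: mulrCA.
Qed.

Lemma preCY_mu_word_corr : word_corr m preCY_mu.
Proof.
apply: (word_corr_basis preCY_mu_linear (cochain_linear (preCY_cochain mP))) => s x.
rewrite pairing_preCY_mu -[dualv x]/(letter_elt d (basis_letter (inr x))).2 -vecs_rcons -elts_rcons.
rewrite -map_rcons tensorB_basis map_rcons letter_tensor_last //.
exact: basis_letter_homog.
Qed.

Lemma preCY_mu_nil : preCY_mu [::] = 0.
Proof.
have T0 i : tensorB [:: basis_vec d i] = 0.
  have := tensorB_basis [:: i] => /= ->; case: i => x //=.
  rewrite /letter_tensor /= (preCY_uncurved mP) mulr0 //.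
by rewrite /preCY_mu big1 // => -[z|z] _; rewrite /= T0 ?mulr0 ?oppr0 scale0r.
Qed.

Lemma preCY_mu_degree (s : seq (gelt B)) : all (@homog K B) s ->
  preCY_mu (vecs s) \in gs_part B (sbar s + 2).
Proof.
move=> hs; apply: memv_suml => j _.
have [->|cj] := eqVneq (mu_coef (vecs s) j) 0; first by rewrite scale0r mem0v.
apply: memvZ.
have hl i : homog (letter_elt d (basis_letter i)).
  apply: letter_homog; exact: (allP (basis_letter_homog [:: i])) (mem_head _ _).
suff -> : sbar s + 2 = (letter_elt d (basis_letter j)).1 by exact: hl.
have E i : tensorB (rcons (vecs s) (basis_vec d i)) != 0 ->
    sbar s + ((letter_elt d (basis_letter i)).1 - 1) = d - 4.
  rewrite -vecs_rcons => /tensorB_degree; rewrite sbar_rcons; apply.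
  by rewrite all_rcons hl.
case: j cj => z /=.
  rewrite oppr_eq0 mulf_eq0 negb_or => /andP[_ /E] /= h.
  have -> : sbar s = sbar s + (d - 1 - bdeg z - 1) - (d - 2 - bdeg z) by ring.
  by rewrite h; ring.
move=> /E /= h; have -> : sbar s = sbar s + (bdeg z - 1) - (bdeg z - 1) by ring.
by rewrite h; ring.
Qed.

Lemma preCY_mu_subalgebra : is_subalgebra preCY_mu.
Proof.
move=> s; rewrite [LHS]dual_expand big1 // => x _.
rewrite -[_ (bvec x)]/(bcoord (inr x) (preCY_mu _)) bcoord_preCY_mu /= -[basis_vec d _]/(inA _ (bvec x)).
rewrite -map_rcons; set t := rcons s _.
suff -> : tensorB (map (inA _) t) = 0 by rewrite scale0r.
apply: (@multi_ext_zero _ _ _ _ (fun j => if j is inl _ then true else false)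
  (fun v : B => v.2 = 0)).
- by move=> v [y|y] //= -> _; rewrite zero_lfunE.
- by move=> v; elim: t => //= y t IH [<-|].
move=> u uP; rewrite /letter_tensor.
have [a ->] : exists a, map (@basis_letter K A) u = map inl a.
  elim: u uP => [|[y|y] u IH] //=; first by exists [::].
  by move=> /IH[a ->]; exists (belt y :: a).
by rewrite split_dual_inl.
Qed.

Lemma preCY_cyclic_Ainf :
  [/\ is_cyclic_Ainf (d - 1) pr preCY_mu, is_subalgebra preCY_mu & word_corr m preCY_mu].
Proof.
split; [|exact: preCY_mu_subalgebra|exact: preCY_mu_word_corr].
split; [|exact: standard_pairingP|exact: preCY_mu_cyclic].
apply: (Ainf_of_necklace m_degree preCY_mu_cyclic preCY_mu_linear preCY_mu_subalgebra preCY_mu_word_corr preCY_mu_nil preCY_mu_degree).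
exact: preCY_necklace mP.
Qed.
End Build.

(** * From cyclic structures to cochains *)

Lemma weave_slot (X Y : Type) (c1 c2 : seq (seq X)) (s1 s2 : seq X) (o : seq Y) :
  (size c1 <= size o)%N ->
  exists u v, forall a, weave (c1 ++ (s1 ++ a :: s2) :: c2) o = u ++ inl a :: v.
Proof.
elim: c1 o => [|s c1 IH] o /= so.
  exists (map inl s1), (map inl s2 ++ if o is y :: o' then inr y :: weave c2 o' else [::]).
  by move=> a; rewrite map_cat -catA.
case: o so => [//|y o] /= /IH[u [v E]].
by exists (map inl s ++ inr y :: u), v => a; rewrite E -catA.
Qed.

Section Recover.
Context (K : fieldType) (A : gradedSpace K) (d : int).
Local Notation B := (dual_double A d).
Local Notation pr := (@standard_pairing K A d).
Local Notation letter := (letter A).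
Local Notation elts := (@word_elts K A d).
Local Notation dualv := (@dual_basis_vec K A d).
Local Notation hom := (all (@homog_letter K A)).
Context (mu : seq B -> B).
Hypothesis muP : is_cyclic_Ainf (d - 1) pr mu.
Hypothesis mu_sub : is_subalgebra mu.
Implicit Types (w : seq letter) (x y z : bidx A).

Let mu_lin : multilinear mu := Ainf_linear (cyclic_Ainf muP).
Let mu_cyc : cyclic_inv pr mu := cyclic_invariant muP.

Definition letter_vec (l : A + bidx A) : B :=
  match l with inl a => inA _ a | inr x => dualv x end.

Definition corr_term x w : K :=
  (-1) ^ corr_sign d (bars w) (bdeg x - 1) * pr (mu (vecs (elts w))) (dualv x).

(** The sign of [corr_sign] involves the degrees of the inputs, so on vectors that
    are not homogeneous the family is defined by extension from the basis. *)
Definition mu_cochain : cochain A := fun c o =>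
  if o is x :: o' then
    if size c == size o then
      multi_ext (@bcoord K A d) (fun s => corr_term x (map (@basis_letter K A) s))
        (map letter_vec (weave c o'))
    else 0
  else 0.

Lemma vecs_elts w : vecs (elts w) = map letter_vec (weave (map (@vecs K A) (groups w)) (duals w)).
Proof.
rewrite -{1}[w]weave_groups /vecs -map_comp.
have -> : weave (map (@vecs K A) (groups w)) (duals w) =
    map (map_letter (fun g : gelt A => g.2) (@id (bidx A))) (weave (groups w) (duals w)).
  by rewrite map_weave map_id.
by rewrite -map_comp; apply: eq_map => -[g|x].
Qed.

Lemma mu_cochain_word w x : hom w ->
  mu_cochain (map (@vecs K A) (groups w)) (x :: duals w) = corr_term x w.
Proof.
move=> hw; rewrite /mu_cochain size_map size_groups /= eqxx -vecs_elts.
apply/eqP; rewrite -subr_eq0; apply/eqP; move: w hw.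
set g := fun s => _.
apply: (@letter_slotwise_zero K A K^o) => [u n v c y z|s]; last first.
  have -> : vecs (elts (map (@basis_letter K A) s)) = map (@basis_vec K A d) s.
    by rewrite /vecs /word_elts -!map_comp.
  by rewrite (multi_ext_basis _ s (@bcoord_basis K A d)) subrr.
have lg := @multi_ext_linear K _ _ _ (@bcoord_linear K A d) g.
rewrite /corr_term !bars_cat !bars_inl /= (mu_letter_linear mu_lin u n v (dualv x) c).
rewrite !elts_cat !vecs_cat /= (inA_linear _ c) lg.
exact: linear_sub_sign.
Qed.

Lemma mu_cochain_corr : word_corr mu_cochain mu.
Proof.
move=> w x hw; rewrite mu_cochain_word // /corr_term mulrA exprN1z.
by rewrite -signr_addb addbb mul1r.
Qed.

Lemma mu_cochain_size c o : size o != size c -> mu_cochain c o = 0.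
Proof. by rewrite /mu_cochain; case: o => //= x o; rewrite eq_sym => /negbTE ->. Qed.

Lemma mu_cochain_linear c1 c2 o :
  multilinear (fun s : seq A => mu_cochain (c1 ++ s :: c2) o : K^o).
Proof.
move=> s1 s2 c u v; rewrite /mu_cochain; case: o => [|x o]; first by rewrite scaler0 addr0.
rewrite !size_cat /=; case: eqP => [so|_]; last by rewrite scaler0 addr0.
have so1 : (size c1 <= size o)%N by move: so; rewrite addnS => -[<-]; exact: leq_addr.
have [p [q E]] := weave_slot c2 s1 s2 so1; rewrite !E !map_cat /= (inA_linear _ c).
exact: (multi_ext_linear (@bcoord_linear K A d)).
Qed.

Lemma weave_homog (c : seq (seq (gelt A))) o : all (all (@homog K A)) c ->
  hom (weave c o).
Proof.
elim: c o => //= a c IH o /andP[ha hc]; rewrite all_cat all_map.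
have -> : all (preim inl (@homog_letter K A)) a = all (@homog K A) a by apply: eq_all.
by rewrite ha; case: o => //= y o; exact: IH.
Qed.

(** A family of groups on which a cochain is nonzero comes from a word. *)
Lemma cochain_word (c : seq (seq (gelt A))) o (phi : cochain A) :
  (forall o, phi [::] o = 0) -> (forall c o, size o != size c -> phi c o = 0) ->
  all (all (@homog K A)) c -> phi (map (@vecs K A) c) o != 0 ->
  exists w x, [/\ hom w, c = groups w & o = x :: duals w].
Proof.
move=> phi0 phis hc; have [so|so] := eqVneq (size o) (size c); last first.
  by rewrite phis ?eqxx // size_map.
case: o so => [/esym/size0nil ->|x o so _]; first by rewrite phi0 eqxx.
exists (weave c o), x; rewrite groups_weave ?duals_weave //; split => //.
exact: weave_homog.
Qed.

Lemma mu_cochain_nil o : mu_cochain [::] o = 0.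
Proof. by case: o => //. Qed.

Lemma mu_cochain_degree : degree_law d mu_cochain.
Proof.
move=> c o hc m0.
have [w [x [hw cE oE]]] := cochain_word mu_cochain_nil mu_cochain_size hc m0.
move: m0; rewrite cE oE mu_cochain_word // mulf_eq0 negb_or => /andP[_].
apply: contra_neq_eq => ne.
have hm : homog (sbar (elts w) + 2, mu (vecs (elts w))).
  by apply: (Ainf_degree (cyclic_Ainf muP)); exact: elts_homog.
have hx := @letter_homog K A d (inr x) isT.
apply: (pairing_degree (standard_pairingP A d) hm hx); apply: contra ne => /= /eqP E.
rewrite -in_bar_bars size_groups big_cons intS -out_num_bars.
have -> : \sum_(y <- duals w) bdeg y = out_bar (bars w) + out_num (bars w).
  rewrite out_bar_bars out_num_bars /obar; elim: (duals w) => [|y o' IH].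
    by rewrite !big_nil.
  by rewrite !big_cons IH /= intS; ring.
move: E; rewrite sbar_elts => E.
set S := in_bar (bars w) + _ - _ in E.
have -> : bdeg x = S + 2.
  rewrite [LHS](_ : _ = S + 2 + (d - 1) - (S + 2 + (d - 1 - bdeg x))); last by ring.
  by rewrite E; ring.
apply/eqP; rewrite /S; ring.
Qed.

(** Rotating the groups by one is rotating the closed word by the block that
    consists of the last group and the first output. *)
Lemma mu_cochain_cyclic (a : seq (gelt A)) (c : seq (seq (gelt A))) x o :
  all (@homog K A) a -> all (all (@homog K A)) c ->
  mu_cochain (rcons (map (@vecs K A) c) (vecs a)) (rcons o x) =
    (-1) ^ (sbar a * sbar (flatten c) + (d - 1) * (size c)%:Z + (bdeg x - 1) * obar o)
    * mu_cochain (vecs a :: map (@vecs K A) c) (x :: o).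
Proof.
move=> ha hc; have [so|so] := eqVneq (size o) (size c); last first.
  by rewrite !mu_cochain_size ?mulr0 ?size_rcons //= ?size_map ?eqSS.
case: o so => [/esym/size0nil ->|x' o so].
  by rewrite /obar big_nil sbar_nil !mulr0 !addr0 expr0z mul1r.
have [v hv [vc vo]] : exists2 v : seq letter, hom v & groups v = c /\ duals v = o.
  by exists (weave c o); rewrite ?weave_homog ?groups_weave ?duals_weave.
have hla : hom (map inl a) by rewrite all_map.
pose w1 : seq letter := v ++ inr x :: map inl a.
pose w2 : seq letter := map inl a ++ inr x' :: v.
have hw1 : hom w1 by rewrite all_cat hv.
have hw2 : hom w2 by rewrite all_cat hla.
have g1 : groups w1 = rcons c a by rewrite groups_cat_inr groups_inl vc cats1.
have g2 : groups w2 = a :: c by rewrite groups_cat_inr groups_inl vc.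
have o1 : duals w1 = rcons o x by rewrite duals_cat vo /= duals_inl cats1.
have o2 : duals w2 = x' :: o by rewrite duals_cat duals_inl /= vo.
rewrite -map_rcons -g1 rcons_cons -o1 mu_cochain_word //.
rewrite -[vecs a :: _]/(map (@vecs K A) (a :: c)) -g2 -o2.
have E : pr (mu (vecs (elts w1))) (dualv x') =
    (-1) ^ ((sbar (elts v) + (d - 2 - bdeg x)) * (sbar a + (d - 2 - bdeg x')))
    * pr (mu (vecs (elts w2))) (dualv x).
  rewrite -[dualv x']/(letter_elt d (inr x')).2 -[dualv x]/(letter_elt d (inr x)).2.
  rewrite -!cyc_rcons -!vecs_rcons -!elts_rcons.
  have -> : rcons w1 (inr x') = rcons v (inr x) ++ rcons (map inl a) (inr x').
    by rewrite cat_rcons /w1 rcons_cat.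
  rewrite elts_cat (cyc_rot mu_cyc) ?elts_homog ?all_rcons //.
  rewrite -elts_cat cat_rcons -rcons_cons -rcons_cat; congr (_ ^ _ * _).
  rewrite (sbar_elts_rcons d v) (sbar_elts_rcons d (map inl a)) sbar_elts_inl /=.
  ring.
have [m0|m0] := eqVneq (mu_cochain (map (@vecs K A) (groups w2)) (x :: duals w2)) 0.
  rewrite (mu_cochain_word x hw2) in m0 *; rewrite m0 mulr0.
  move/eqP: m0; rewrite /corr_term E.
  by rewrite mulf_eq0 exprN1z signr_eq0 /= => /eqP ->; rewrite !mulr0.
have := word_parity mu_cochain_degree hw2 m0.
rewrite (mu_cochain_word x hw2) /corr_term E.
rewrite !mulrA !sign_mul => P; congr (_ * _); apply: sign_congr; move: P; apply: parity_eq_if.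
rewrite o2 -(cat1s x') /obar big_cat big_seq1 -/(obar _) -vo -out_bar_bars -vc -in_bar_bars size_groups.
rewrite /corr_sign /w1 /w2 !barsE !wordE !word_sign_cat /= !wordE !word_sign_inl.
rewrite !sbar_elts out_bar_bars_inl out_num_bars_inl in_bar_bars_inl intS -out_num_bars.
by rewrite !oddzE; truth_table.
Qed.

Lemma mu_cochain_preCY : is_preCY d mu_cochain.
Proof.
have mc : is_cochain d 2 mu_cochain.
  split; [exact: mu_cochain_nil|exact: mu_cochain_size|exact: mu_cochain_linear|
    exact: mu_cochain_degree|].
  by move=> a c x o; exact: mu_cochain_cyclic.
split=> [//|c [|x o] hc /= so|[|x o]]; rewrite ?mu_cochain_nil //.
- by move/esym/size0nil: so => ->; rewrite /necklace big_geq.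
- have hw := weave_homog o hc.
  have := necklace_relation mu_cochain_degree mu_cyc mu_lin mu_sub mu_cochain_corr x hw.
  rewrite groups_weave ?duals_weave //; try by rewrite -so.
  rewrite (Ainf_relation (cyclic_Ainf muP)) ?elts_homog //.
  rewrite (@linear_zero _ _ K^o (pr^~ (dualv x)) (standard_pairing_linearl _)) => /esym/eqP.
  by rewrite mulf_eq0 exprN1z signr_eq0 /= => /eqP.
have [so|so] := eqVneq (size (x :: o)) 1%N; last exact: mu_cochain_size.
case: o so => // _; rewrite (mu_cochain_word x (isT : hom [::])).
rewrite /corr_term (Ainf_nil (cyclic_Ainf muP)).
by rewrite (@linear_zero _ _ K^o (pr^~ (dualv x)) (standard_pairing_linearl _)) mulr0.
Qed.
End Recover.

(** * The correspondence on arbitrary functionals *)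

Section TensorEval.
Context (K : fieldType) (A : gradedSpace K).
Implicit Types (t : tensor A) (f : 'Hom(A, K^o)) (s : seq 'Hom(A, K^o)).

Lemma tensor_eval_nil t : tensor_eval t [::] = t [::].
Proof.
rewrite /tensor_eval (big_pred1 [tuple]) => [|x]; last by apply/esym/eqP; exact: tuple0.
by rewrite big_nil mulr1.
Qed.

Lemma tensor_eval_cons t f s : tensor_eval t (f :: s) =
  \sum_x (f (bvec x) : K) * tensor_eval (fun o => t (x :: o)) s.
Proof.
rewrite /tensor_eval.
transitivity (\sum_(p : bidx A * (size s).-tuple (bidx A))
   (f (bvec p.1) : K) * (t (p.1 :: p.2) * \prod_(fx <- zip s p.2) (fx.1 (bvec fx.2) : K))).
  rewrite (reindex (fun p : bidx A * (size s).-tuple (bidx A) => [tuple of p.1 :: p.2])) /=.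
    by apply: eq_bigr => -[x o] _ /=; rewrite big_cons /= mulrCA.
  exists (fun o : (size s).+1.-tuple (bidx A) => (thead o, [tuple of behead o])).
    move=> [x o] _; rewrite theadE; congr pair; exact: val_inj.
  by move=> o _; rewrite [RHS]tuple_eta; exact: val_inj.
rewrite -(pair_bigA _ (fun x (o : (size s).-tuple (bidx A)) =>
  (f (bvec x) : K) * (t (x :: o) * \prod_(fx <- zip s o) (fx.1 (bvec fx.2) : K)))) /=.
by apply: eq_bigr => x _; rewrite mulr_sumr.
Qed.

Lemma tensor_eval_linear t s1 s2 :
  linear (fun f => tensor_eval t (s1 ++ f :: s2) : K^o).
Proof.
elim: s1 t => [|g s1 IH] t c u v /=; rewrite !tensor_eval_cons scaler_sumr -big_split.
  apply: eq_bigr => x _ /=; rewrite add_lfunE scale_lfunE mulrDl; congr (_ + _).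
  by rewrite -mulrA.
by apply: eq_bigr => x _ /=; rewrite IH mulrDr; congr (_ + _); exact: mulrCA.
Qed.

Lemma tensor_eval_basis t (o : seq (bidx A)) : tensor_eval t (map (@dvec K A) o) = t o.
Proof.
elim: o t => [|x o IH] t /=; first exact: tensor_eval_nil.
rewrite tensor_eval_cons (bigD1 x) //= dvec_bvec eqxx mul1r IH big1 ?addr0 // => y yx.
by rewrite dvec_bvec eq_sym (negbTE yx) mul0r.
Qed.
End TensorEval.

Lemma weave_slot_dual (X Y : Type) (c : seq (seq X)) (o1 o2 : seq Y) :
  (size o1 < size c)%N ->
  exists u v, forall y, weave c (o1 ++ y :: o2) = u ++ inr y :: v.
Proof.
elim: o1 c => [|z o1 IH] [|a c] //= so.
  by exists (map inl a), (weave c o2).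
by have [u [v E]] := IH c so; exists (map inl a ++ inr z :: u), v => y; rewrite E -catA.
Qed.

Section Corresponds.
Context (K : fieldType) (A : gradedSpace K) (d : int).
Local Notation B := (dual_double A d).
Local Notation V := (gshift (gdual A) (1 - d)).
Local Notation pr := (@standard_pairing K A d).
Local Notation letter := (letter A).
Local Notation elts := (@word_elts K A d).
Local Notation dualv := (@dual_basis_vec K A d).
Local Notation hom := (all (@homog_letter K A)).

(** A functional f of degree n in A^v[1 - d] is dual to elements of degree
    d - 1 - n in A, hence of degree d - 2 - n in A[1]. *)
Definition degree_sign (cs : seq (seq int)) (fs : seq int) : bool :=
  oddz (corr_sign d
    (weave (map (map (fun n => n - 1)) cs) (map (fun n => d - 2 - n) (behead fs)))
    (d - 2 - head 0 fs)).

Definition mixed_vec (l : A + V) : B :=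
  match l with inl a => inA _ a | inr f => inV _ f end.

(** The argument of mu in [corresponds] is a word in the sense of [weave]. *)
Lemma weave_flatten (a : seq A) (c : seq (seq A)) (g : seq V) : size g = size c ->
  map (inA _) a ++ flatten [seq (inV _ gb.1 : B) :: map (inA _) gb.2 | gb <- zip g c]
  = map mixed_vec (weave (a :: c) g).
Proof.
elim: g c a => [|f g IH] [|b c] a //= => [_|[/IH E]].
  by rewrite map_cat -map_comp.
by rewrite map_cat -map_comp /= E.
Qed.

Definition dual_elt (x : bidx A) : gelt V := (d - 1 - bdeg x, dvec x).

Variables (m : cochain A) (mu : seq B -> B).
Hypothesis mu_lin : multilinear mu.
Hypothesis corr : word_corr m mu.

Lemma corresponds_basis (a : seq (gelt A)) (c : seq (seq (gelt A))) x (o : seq (bidx A)) :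
  all (@homog K A) a -> all (all (@homog K A)) c -> size o = size c ->
  pr (mu (map mixed_vec (weave (map (@vecs K A) (a :: c)) (map (@dvec K A) o)))) (dualv x)
  = (-1) ^+ degree_sign (map (@degs K A) (a :: c)) (degs (map dual_elt (x :: o)))
    * m (map (@vecs K A) (a :: c)) (x :: o).
Proof.
move=> ha hc so; pose w : seq letter := weave (a :: c) o.
have sc : size (a :: c) = (size o).+1 by rewrite /= so.
have hw : hom w by apply: weave_homog; rewrite /= ha.
have -> : map mixed_vec (weave (map (@vecs K A) (a :: c)) (map (@dvec K A) o)) = vecs (elts w).
  rewrite -(map_weave (fun g : gelt A => g.2) (@dvec K A) (a :: c) o) /vecs /word_elts -!map_comp.
  by apply: eq_map => -[].
rewrite (corr x hw) groups_weave // duals_weave // exprN1z; congr ((-1) ^+ nat_of_bool (oddz _) * _).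
congr (corr_sign d _ _); last by rewrite /=; ring.
have -> : bars w = weave (map (map (fun g : gelt A => g.1 - 1)) (a :: c)) (map (fun y => bdeg y - 1) o).
  by rewrite -map_weave.
congr weave.
  by rewrite -map_comp; apply: eq_map => s; rewrite /= /degs -map_comp.
rewrite /= /degs -!map_comp; apply: eq_map => y /=; ring.
Qed.

Lemma word_corr_corresponds : corresponds degree_sign m mu.
Proof.
move=> a c f g ha hc hf hg sg.
pose F (fs : seq (gelt V)) : K^o := if fs is f :: g then
   if size g == size c then
     pr (mu (map mixed_vec (weave (map (@vecs K A) (a :: c)) (vecs g)))) (inV _ f.2)
     - (-1) ^+ degree_sign (map (@degs K A) (a :: c)) (degs (f :: g))
        * tensor_eval (m (map (@vecs K A) (a :: c))) (vecs (f :: g))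
   else 0 else 0.
suff F0 fs : all (@homog K V) fs -> F fs = 0.
  have /= := F0 (f :: g); rewrite sg eqxx hf hg => /(_ isT)/eqP.
  rewrite subr_eq0 => /eqP <-; congr (pr (mu _) _).
  by apply: weave_flatten; rewrite !size_map.
move: fs {f g hf hg sg}; apply: (@slotwise_zero _ _ _ _ dual_elt) => [u [n f] v hf F0|[|x o]]; last 2 first.
- by [].
- rewrite /F /= size_map; case: eqP => // so.
  rewrite -[inV _ (dvec x : V)]/(dualv x).
  have -> : vecs (map dual_elt o) = map (@dvec K A) o by rewrite /vecs -map_comp.
  rewrite -[dvec x :: _]/(map (@dvec K A) (x :: o)) tensor_eval_basis.
  by rewrite [X in X - _](corresponds_basis x ha hc so) subrr.
have lF : linear (fun f => F (u ++ (n, f) :: v)).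
  have sE (s : seq (gelt V)) f' : size (s ++ (n, f') :: v) = (size s + size v).+1.
    by rewrite size_cat addnS.
  move=> e y z; case: u {F0} => [|f' u]; rewrite /F ?cat0s ?cat_cons ?sE;
    case: eqP => [so|_]; rewrite ?scaler0 ?addr0 //.
    rewrite (inV_linear _ e) (standard_pairing_linearr _ e).
    rewrite (tensor_eval_linear _ [::] (vecs v) e); exact: linear_sub_sign.
  have so' : (size (vecs u) < size (map (@vecs K A) (a :: c)))%N.
    by rewrite !size_map /= -so; apply: leqW; rewrite ltnS leq_addr.
  have [p [q E]] := weave_slot_dual (vecs v) so'.
  have Ev (h : V) : weave (map (@vecs K A) (a :: c)) (vecs (u ++ (n, h) :: v)) = p ++ inr h :: q.
    by rewrite vecs_cat -E.
  have Et (h : V) : vecs (f' :: u ++ (n, h) :: v) = (f'.2 :: vecs u) ++ h :: vecs v.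
    by rewrite -cat_cons vecs_cat.
  have Ed (h : V) : degs (f' :: u ++ (n, h) :: v) = degs (f' :: u ++ (n, 0) :: v).
    by rewrite /degs !map_cons !map_cat.
  have Em (h : V) : map mixed_vec (p ++ inr h :: q) =
      map mixed_vec p ++ (inV _ h : B) :: map mixed_vec q by rewrite map_cat.
  rewrite !Ev !Et !(Ed (_ + _)) !(Ed y) !(Ed z) !Em (inV_linear _ e) mu_lin.
  rewrite (standard_pairing_linearl _ e (mu _) (mu _)).
  rewrite (tensor_eval_linear _ (f'.2 :: vecs u) (vecs v) e); exact: linear_sub_sign.
rewrite {1}[f]dual_expand (linear_big_sum lF) big1 // => x _; rewrite (linear_scale lF).
have [xn|xn] := eqVneq (bdeg x) (d - 1 - n); last by rewrite (dual_homog hf xn) scale0r.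
have := F0 x; rewrite /dual_elt xn (_ : d - 1 - (d - 1 - n) = n); last by ring.
by move->; rewrite scaler0.
Qed.
End Corresponds.

(** * Uniqueness and the equivalence *)

Section Uniqueness.
Context (K : fieldType) (A : gradedSpace K) (d : int).
Local Notation B := (dual_double A d).
Local Notation pr := (@standard_pairing K A d).
Local Notation letter := (letter A).
Local Notation elts := (@word_elts K A d).
Local Notation dualv := (@dual_basis_vec K A d).
Local Notation hom := (all (@homog_letter K A)).

Lemma cyc_linear (mu : seq B -> B) u v : multilinear mu ->
  linear (fun x => cyc pr mu (u ++ x :: v) : K^o).
Proof.
move=> mu_lin; case/lastP: v => [|v z] c x y.
  by rewrite !cats1 !cyc_rcons; exact: (standard_pairing_linearr _ c).
rewrite -!rcons_cons -!rcons_cat !cyc_rcons mu_lin.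
exact: (standard_pairing_linearl z c (mu _) (mu _)).
Qed.

(** By rotation, the tensor of mu is determined by its values on words ending with
    a dual letter and on words in A, and nondegeneracy recovers mu. *)
Lemma word_corr_mu_unique (m : cochain A) (mu mu' : seq B -> B) :
  is_cyclic_Ainf (d - 1) pr mu -> is_subalgebra mu -> word_corr m mu ->
  is_cyclic_Ainf (d - 1) pr mu' -> is_subalgebra mu' -> word_corr m mu' ->
  mu = mu'.
Proof.
move=> muP mu_sub corr muP' mu_sub' corr'.
have lin := Ainf_linear (cyclic_Ainf muP); have lin' := Ainf_linear (cyclic_Ainf muP').
have words w : hom w -> cyc pr mu (vecs (elts w)) = cyc pr mu' (vecs (elts w)).
  move=> hw; have := split_dualP w; case: split_dual => [[[a y] v] E|[a ->]].
    have hE : hom (rcons (map inl a) (inr y)) && hom v by rewrite -all_cat cat_rcons -E.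
    case/andP: hE => h1 h2; have h1' := h1; rewrite all_rcons in h1'.
    have h3 : hom (v ++ map inl a) by rewrite all_cat h2.
    rewrite E -cat_rcons elts_cat (cyc_rot (cyclic_invariant muP)) ?elts_homog //.
    rewrite (cyc_rot (cyclic_invariant muP')) ?elts_homog //.
    rewrite -elts_cat -rcons_cat elts_rcons vecs_rcons !cyc_rcons.
    by rewrite [pr (mu _) _](corr _ y h3) [pr (mu' _) _](corr' _ y h3).
  case/lastP: a => [//|a g]; rewrite map_rcons elts_rcons vecs_rcons !cyc_rcons.
  by rewrite vecs_elts_inl !standard_pairing_inA mu_sub mu_sub'.
have cycE s : cyc pr mu s = cyc pr mu' s.
  apply/eqP; rewrite -subr_eq0; apply/eqP; move: s.
  apply: (@vector_slotwise_zero K A d K^o) => [u v c x y|s].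
    rewrite [X in X - _](cyc_linear u v lin c) [X in _ - X](cyc_linear u v lin' c).
    by rewrite opprD addrACA scalerBr.
  by rewrite words ?subrr //; exact: basis_letter_homog.
apply: funext => s; apply/eqP; rewrite -subr_eq0; apply/eqP.
apply: (pairing_nondegenerate (standard_pairingP A d)) => y.
have lp : linear (pr^~ y : B -> K^o) := standard_pairing_linearl y.
by rewrite (linear_add lp) -scaleN1r (linear_scale lp) scaleN1r -!cyc_rcons cycE subrr.
Qed.

Lemma word_corr_cochain_unique (m m' : cochain A) (mu : seq B -> B) p :
  is_cochain d p m -> is_cochain d p m' -> word_corr m mu -> word_corr m' mu -> m = m'.
Proof.
move=> mP mP' corr corr'; apply: funext => c; apply: funext => o.
have [so|so] := eqVneq (size o) (size c); last first.
  by rewrite (cochain_size mP) // (cochain_size mP').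
case: o so => [/esym/size0nil ->|x o so]; first by rewrite (cochain_nil mP) (cochain_nil mP').
have sc : size c = (size o).+1 by rewrite -so.
suff words w : m (groups w) (x :: duals w) = m' (groups w) (x :: duals w).
  by have := words (weave c o); rewrite groups_weave // duals_weave.
apply/eqP; rewrite -subr_eq0; apply/eqP.
pose b (j : basis_index A) : A + bidx A :=
  match j with inl x => inl (bvec x) | inr x => inr x end.
pose F (w : seq (A + bidx A)) : K^o := m (groups w) (x :: duals w) - m' (groups w) (x :: duals w).
apply: (@slotwise_zero _ _ _ K^o b xpredT F); last exact: all_predT.
  move=> u [a|y] v _ F0; last exact: (F0 (inr y)).
  have dE (a' : A) : duals (u ++ inl a' :: v) = duals (u ++ v) by rewrite !duals_cat.
  have lF : linear (fun a => F (u ++ inl a :: v)).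
    move=> e y z; rewrite /F !dE.
    rewrite (cochain_slot_linear (cochain_linear mP) u v _ e).
    rewrite (cochain_slot_linear (cochain_linear mP') u v _ e).
    by rewrite opprD addrACA scalerBr.
  rewrite [a]basis_expand (linear_big_sum lF) big1 // => y _.
  by rewrite (linear_scale lF) (F0 (inl y)) scaler0.
move=> s; rewrite /F; set w' := map (@basis_letter K A) s.
have -> : map b s = map (map_letter (fun g : gelt A => g.2) (@id (bidx A))) w'.
  by rewrite -map_comp; apply: eq_map => -[].
rewrite groups_map duals_map map_id.
have hw : hom w' by exact: basis_letter_homog.
have := corr w' x hw; rewrite (corr' w' x hw) exprN1z.
by move/mulfI => <-; rewrite ?signr_eq0 // subrr.
Qed.
End Uniqueness.

Theorem proposition9 (K : fieldType) (charK : [pchar K] =i pred0)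
    (A : gradedSpace K) (d : int) :
  exists (eps : seq (seq int) -> seq int -> bool)
         (Phi : cochain A -> (seq (dual_double A d) -> dual_double A d)),
    set_bij [set m | is_preCY d m]
            [set mu | is_cyclic_Ainf (d - 1) (@standard_pairing K A d) mu
                      /\ is_subalgebra mu]
            Phi
    /\ forall m, is_preCY d m -> corresponds eps m (Phi m).
Proof.
exists (degree_sign d), (@preCY_mu K A d); split; last first.
  move=> m mP; have [muP _ corr] := preCY_cyclic_Ainf mP.
  exact: word_corr_corresponds (Ainf_linear (cyclic_Ainf muP)) corr.
split=> [m mP|m m' /set_mem mP /set_mem mP' E|mu [muP mu_sub]].
- by have [muP mu_sub _] := preCY_cyclic_Ainf mP.
- have [_ _ corr] := preCY_cyclic_Ainf mP; have [_ _ corr'] := preCY_cyclic_Ainf mP'.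
  rewrite E in corr.
  exact: word_corr_cochain_unique (preCY_cochain mP) (preCY_cochain mP') corr corr'.
have mP := mu_cochain_preCY muP mu_sub.
exists (mu_cochain mu) => //.
have [muP' mu_sub' corr'] := preCY_cyclic_Ainf mP.
exact: word_corr_mu_unique muP' mu_sub' corr' muP mu_sub (mu_cochain_corr muP).
Qed.
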